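(* Let $\mathcal{M}$ be the maximal robust positively invariant set contained in $G$ of the constrained system $\dot{x}(t)=f(x(t),d(t))$, $x(t_0)=x_0$, $d\in\mathcal{D}$, $g_i(x(t))\le 0$ for all $t\in[t_0,\infty)$, $i=1,\dots,p$. Assume: (A1) $\mathcal{D}$ is the set of all Lebesgue measurable functions mapping $[t_0,\infty)$ to a set $D\subset\mathbb{R}^m$ which is compact and convex. (A2) $f$ is $C^2$ with respect to $d\in D$, and for every $d$ in an open subset containing $D$, $f$ is $C^2$ with respect to $x\in\mathbb{R}^n$. (A3) Every $x_0$ with $\|x_0\|<\infty$ and every $d\in\mathcal{D}$ admits a unique absolutely continuous integral curve of the system that remains bounded over any finite time interval. (A4) The set $f(x,D)=\{f(x,d): d\in D\}$ is convex for all $x\in\mathbb{R}^n$. (A5) For every $i$ the function $g_i$ is $C^2$ with respect to $x\in\mathbb{R}^n$, and the set $\{x: g_i(x)=0\}$ defines a manifold. (A6) There exists a finite time $T\ge t_0$ such that $\mathcal{M}_T=\mathcal{M}$. Let $\bar{x}\in[\partial\mathcal{M}]_-$, $\bar{d}\in\mathcal{D}$ and a finite time $\bar{t}$ be such that the integral curve $x^{(\bar{d})}:=x^{(\bar{d},\bar{x},t_0)}$ satisfies $x^{(\bar{d})}(t)\in[\partial\mathcal{M}]_-$ for all $t\in[t_0,\bar{t})$ and $z:=x^{(\bar{d})}(\bar{t})\in G_0$. Then there exist an index $i^*\in\mathbb{I}(z)$ with $L_fg_{i^*}(z,\bar{d}(\bar{t}))=\max_{i\in\mathbb{I}(z)}L_fg_i(z,\bar{d}(\bar{t}))$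 and a nonzero absolutely continuous maximal solution $\lambda^{\bar{d}}$ to the adjoint equation $$\dot{\lambda}^{\bar{d}}(t)=-\left(\frac{\partial f}{\partial x}(x^{(\bar{d})}(t),\bar{d}(t))\right)^T\lambda^{\bar{d}}(t),\qquad \lambda^{\bar{d}}(\bar{t})=(\nabla g_{i^*}(z))^T,$$ such that $$\max_{d\in D}\{\lambda^{\bar{d}}(t)^Tf(x^{(\bar{d})}(t),d)\}=\lambda^{\bar{d}}(t)^Tf(x^{(\bar{d})}(t),\bar{d}(t))=0$$ for almost every $t\in[t_0,\bar{t}]$. Moreover, at $\bar{t}$ the ultimate tangentiality condition holds: $$\max_{d\in D}\max_{i\in\mathbb{I}(z)}L_fg_i(z,d)=\max_{i\in\mathbb{I}(z)}L_fg_i(z,\bar{d}(\bar{t}))=L_fg_{i^*}(z,\bar{d}(\bar{t}))=0.$$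
   Context: Setting: $x(t)\in\mathbb{R}^n$ is the state and $d(t)\in\mathbb{R}^m$ is a disturbance. $x^{(d,x_0,t_0)}$ is the solution of $\dot{x}(t)=f(x(t),d(t))$ with initial condition $x_0$ at time $t_0$ and disturbance realisation $d\in\mathcal{D}$, and $x^{(d,x_0,t_0)}(t)$ is its value at time $t\in[t_0,\infty)$. Sets: $G=\{x\in\mathbb{R}^n: g_i(x)\le 0,\ i=1,\dots,p\}$, $G_-=\{x\in\mathbb{R}^n: g_i(x)<0,\ i=1,\dots,p\}$, $G_0=\{x\in\mathbb{R}^n: \exists i,\ g_i(x)=0\}$, and $\mathbb{I}(x)=\{i\in\{1,\dots,p\}: g_i(x)=0\}$. The gradient $\nabla g_i(x)$ is a row vector and the Lie derivative is $L_fg_i(x,d)=\nabla g_i(x)\cdot f(x,d)$. A set $\Omega\subset\mathbb{R}^n$ is a robust positively invariant set (RPI) of the system if $x^{(d,x_0,t_0)}(t)\in\Omega$ for all $t\in[t_0,\infty)$, all $x_0\in\Omega$ and all $d\in\mathcal{D}$. The maximal robust positively invariant set $\mathcal{M}$ contained in $G$ is the union of all RPIs that are subsets of $G$. Its invariance barrier is $[\partial\mathcal{M}]_-=\partial\mathcal{M}\cap G_-$. For $T<\infty$, $$\mathcal{M}_T=\{x_0 : x^{(d,x_0,t_0)}(t)\in G \text{ for all } t\in[t_0,T] \text{ and all } d\in\mathcal{D}\}.$$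
   Formalization: The value d̄(t̄) is assumed to be an essential cluster value of d̄ from the left (else changing d̄ at t̄ alone refutes the claim); C² in x (resp. d) means partials jointly continuous in (x,d); ''{g_i=0} defines a manifold'' means ∇g_i≠0 wherever g_i=0. *)

(* Defs.v *)
From HB Require Import structures.
From mathcomp Require Import all_boot all_order all_algebra.
From mathcomp Require Import all_classical all_reals all_analysis.
From mathcomp Require Import measurable_realfun.

Set Implicit Arguments.
Unset Strict Implicit.
Unset Printing Implicit Defensive.

Import Order.TTheory GRing.Theory Num.Theory.
Import numFieldNormedType.Exports.

Local Open Scope classical_set_scope.
Local Open Scope ring_scope.

(* States and disturbance values are column vectors, gradients are row vectors.
   Time-dependent objects are total functions on R of which only the values on
   [t0, +oo[ matter. *)

Definition is_max_over {R : realType} {T : Type} (A : set T) (h : T -> R)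
    (v : R) : Prop :=
  (exists2 a, A a & h a = v) /\ (forall a, A a -> h a <= v).

Definition boundary {T : topologicalType} (A : set T) : set T :=
  closure A `\` interior A.

Definition convex_subset {R : realType} {V : lmodType R} (A : set V) : Prop :=
  forall a b (s : R), A a -> A b -> 0 <= s -> s <= 1 ->
    A (s *: a + (1 - s) *: b).

Section Smoothness.
Context {R : realType} {V P W : normedModType R}.

Definition jointly_continuous_on (U : set P) (h : V -> P -> W) : Prop :=
  forall x q, U q -> {for (x, q), continuous (fun y : V * P => h y.1 y.2)}.

(* [U] is meant to be open.  Quantifying over all directions u, v instead of
   the basis vectors is the same in finite dimension.  As usual for functions
   of several groups of variables, the derivatives with respect to one group
   are required to be continuous in all the variables. *)
Definition C2_in_fst (U : set P) (h : V -> P -> W) : Prop :=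
  let D1 u := fun x q => 'D_u (h^~ q) x in
  let D2 u v := fun x q => 'D_v (fun y => D1 u y q) x in
  [/\ jointly_continuous_on U h,
      forall u x q, U q -> derivable (h^~ q) x u,
      forall u, jointly_continuous_on U (D1 u),
      forall u v x q, U q -> derivable (fun y => D1 u y q) x v &
      forall u v, jointly_continuous_on U (D2 u v)].

Definition C2_in_snd (U : set P) (h : V -> P -> W) : Prop :=
  let D1 u := fun x q => 'D_u (h x) q in
  let D2 u v := fun x q => 'D_v (D1 u x) q in
  [/\ jointly_continuous_on U h,
      forall u x q, U q -> derivable (h x) q u,
      forall u, jointly_continuous_on U (D1 u),
      forall u v x q, U q -> derivable (D1 u x) q v &
      forall u v, jointly_continuous_on U (D2 u v)].

Definition C2 (h : V -> W) : Prop :=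
  [/\ continuous h,
      forall u x, derivable h x u,
      forall u, continuous ('D_u h),
      forall u v x, derivable ('D_u h) x v &
      forall u v, continuous ('D_v ('D_u h))].

End Smoothness.

Section Gradient.
Context {R : realType} {n : nat}.

Definition grad (h : 'cV[R]_n -> R) (x : 'cV[R]_n) : 'rV[R]_n :=
  \row_j 'D_(delta_mx j 0) h x.

Definition jacobian_mx (F : 'cV[R]_n -> 'cV[R]_n) (x : 'cV[R]_n) : 'M[R]_n :=
  \matrix_(i, j) ('D_(delta_mx j 0) F x) i 0.

(* The equation h = 0 defines a manifold: 0 is a regular value of h, so that
   the zero set is an (n - 1)-dimensional manifold with defining function h.
   That the bare set is a manifold is not enough: x |-> x ^+ 3 cuts out a point
   of the line with vanishing gradient. *)
Definition defines_manifold (h : 'cV[R]_n -> R) : Prop :=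
  forall x, h x = 0 -> grad h x != 0.

End Gradient.

Definition abs_continuous {R : realType} {V : normedModType R} (a b : R)
    (x : R -> V) : Prop :=
  forall e : R, 0 < e -> exists2 delta : R, 0 < delta &
    forall (N : nat) (l r : 'I_N -> R),
      (forall k, [/\ a <= l k, l k <= r k & r k <= b]) ->
      (forall k k', k != k' -> r k <= l k' \/ r k' <= l k) ->
      \sum_k (r k - l k) < delta ->
      \sum_k `|x (r k) - x (l k)| < e.

(* Caratheodory solution of x' = F t x on the whole of [t0, +oo[. *)
Definition integral_curve {R : realType} {n : nat} (t0 : R)
    (F : R -> 'cV[R]_n -> 'cV[R]_n) (x : R -> 'cV[R]_n) : Prop :=
  (forall b, t0 <= b -> abs_continuous t0 b x) /\
  {ae lebesgue_measure, forall t : R, t0 <= t ->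
     is_derive t (1 : R) x (F t (x t))}.

Definition Lebesgue_measurable_fun {R : realType} (A : set R) (h : R -> R) :
    Prop :=
  @measurable_fun _ _
    (g_sigma_algebraType (completed_algebra_gen (@lebesgue_measure R)))
    R A h.

Section ControlSystem.
Context {R : realType} {n m p : nat}.
Variables (t0 : R) (f : 'cV[R]_n -> 'cV[R]_m -> 'cV[R]_n).
Variables (D : set 'cV[R]_m) (g : 'I_p -> 'cV[R]_n -> R).

Definition disturbances : set (R -> 'cV[R]_m) :=
  [set d | (forall t, t0 <= t -> D (d t)) /\
           forall j, Lebesgue_measurable_fun `[t0, +oo[ (fun t => d t j 0)].

(* x is the curve x^(d, x0, t0) on [t0, +oo[. *)
Definition trajectory (d : R -> 'cV[R]_m) (x0 : 'cV[R]_n)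
    (x : R -> 'cV[R]_n) : Prop :=
  integral_curve t0 (fun t y => f y (d t)) x /\ x t0 = x0.

Definition bounded_on_finite_intervals (x : R -> 'cV[R]_n) : Prop :=
  forall b, exists K : R, forall t, t0 <= t -> t <= b -> `|x t| <= K.

Definition well_posed : Prop :=
  forall x0 d, disturbances d ->
    exists x, [/\ trajectory d x0 x, bounded_on_finite_intervals x &
      forall y, trajectory d x0 y -> forall t, t0 <= t -> y t = x t].

Definition Gset : set 'cV[R]_n := [set x | forall i, g i x <= 0].
Definition Gminus : set 'cV[R]_n := [set x | forall i, g i x < 0].
Definition Gzero : set 'cV[R]_n := [set x | exists i, g i x = 0].

Definition active (x : 'cV[R]_n) : set 'I_p := [set i | g i x = 0].

Definition Lie (i : 'I_p) (x : 'cV[R]_n) (d : 'cV[R]_m) : R :=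
  (grad (g i) x *m f x d) 0 0.

(* The maximum of the L_f g_i(x, d) over the active indices: a sup over a finite
   set, hence attained when some constraint is active. *)
Definition max_active_Lie (x : 'cV[R]_n) (d : 'cV[R]_m) : R :=
  sup [set Lie i x d | i in active x].

Definition RPI (Omega : set 'cV[R]_n) : Prop :=
  forall x0 d x, Omega x0 -> disturbances d -> trajectory d x0 x ->
    forall t, t0 <= t -> Omega (x t).

Definition MRPI : set 'cV[R]_n :=
  \bigcup_(Omega in [set A | RPI A /\ A `<=` Gset]) Omega.

Definition MRPI_upto (T : R) : set 'cV[R]_n :=
  [set x0 | forall d x, disturbances d -> trajectory d x0 x ->
              forall t, t0 <= t -> t <= T -> Gset (x t)].

Definition barrier : set 'cV[R]_n := boundary MRPI `&` Gminus.

(* The adjoint equation is linear with locally bounded coefficients on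
   [t0, +oo[, so its maximal solutions are those defined on all of [t0, +oo[. *)
Definition adjoint_curve (d : R -> 'cV[R]_m) (x lambda : R -> 'cV[R]_n) :
    Prop :=
  integral_curve t0
    (fun t l => - ((jacobian_mx (f^~ (d t)) (x t))^T *m l)) lambda.

End ControlSystem.

(* The trajectories see d only up to a null set, so that the single value d t
   has no meaning before d is normalized at t.  The normalization says that d t
   is an essential cluster value of d on the left of t; it holds when t is a
   left Lebesgue point of d, and any disturbance can be made to satisfy it by
   changing its value at t only (see [normalized_at_left_repr]). *)
Definition normalized_at_left {R : realType} {m : nat} (d : R -> 'cV[R]_m)
    (t : R) : Prop :=
  forall e delta : R, 0 < e -> 0 < delta ->
    ~ (@lebesgue_measure R).-negligible
        [set s | [/\ t - delta < s, s < t & `|d s - d t| < e]].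

Lemma normalized_at_left_repr {R : realType} {m : nat} (t0 t : R)
    (D : set 'cV[R]_m) (d : R -> 'cV[R]_m) :
  t0 < t -> compact D -> (forall s, t0 <= s -> D (d s)) ->
  exists2 v, D v & normalized_at_left (fun s => if s == t then v else d s) t.
Proof.
move=> t0t; rewrite compact_cover => cD dD; apply: contrapT => noV.
pose S v (e delta : R) := [set s | [/\ t - delta < s, s < t & `|d s - v| < e]].
have /choice[r rP] : forall v, exists r : R * R, D v ->
    [/\ 0 < r.1, 0 < r.2 & lebesgue_measure.-negligible (S v r.1 r.2)].
  move=> v; have [Dv|nDv] := pselect (D v); last by exists (0, 0).
  apply: contrapT => nr; apply: noV; exists v => // e delta e0 delta0 neg.
  apply: nr; exists (e, delta) => _; split => //=.
  apply: negligibleS neg => s [/= ts st sv]; split => //.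
  by rewrite eqxx (lt_eqF st).
have [|v Dv|F FD Fcov] := cD 'cV[R]_m D (fun v => ball v (r v).1).
- by move=> v Dv; apply: ball_open; case: (rP _ Dv).
- by exists v => //; apply: ballxx; case: (rP _ Dv).
have [dl [dl0 dlt neg]] : exists dl, [/\ 0 < dl, dl <= t - t0 &
    lebesgue_measure.-negligible [set s | [/\ t - dl < s, s < t &
      exists2 v, v \in finmap.enum_fset F & `|d s - v| < (r v).1]]].
  have : {subset finmap.enum_fset F <= D} by [].
  elim: (finmap.enum_fset F) => [|v l IH] sub.
    exists (t - t0); split; [by rewrite subr_gt0|by []|].
    by apply: negligibleS (negligible_set0 _) => s [_ _ []].
  have [|dl [dl0 dlt neg]] := IH.
    by move=> w wl; apply: sub; rewrite inE wl orbT.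
  have [_ r0 negv] := rP v (set_mem (sub v (mem_head _ _))).
  exists (Num.min dl (r v).2); split.
  - by rewrite lt_min dl0.
  - by rewrite ge_min dlt.
  apply: negligibleS (negligibleU negv neg) => s [/= ts st [w]].
  have t1 : t - dl < s.
    by apply: le_lt_trans ts; rewrite lerD2l lerN2 ge_min lexx.
  have t2 : t - (r v).2 < s.
    by apply: le_lt_trans ts; rewrite lerD2l lerN2 ge_min lexx orbT.
  by rewrite inE => /predU1P[->|wl] sw; [left|right]; split => //; exists w.
have : lebesgue_measure.-negligible (`]t - dl, t[%classic : set R).
  apply: negligibleS neg => s; rewrite /= in_itv/= => /andP[ts st].
  split => //.
  have t0s : t0 <= s by apply/ltW/(le_lt_trans _ ts); rewrite lerBrDr -lerBrDl.
  have [v vF sv] := Fcov _ (dD _ t0s).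
  by exists v => //; rewrite distrC; rewrite -ball_normE in sv.
have mI : measurable (`]t - dl, t[%classic : set (measurableTypeR R)).
  exact: (@measurable_itv R `]t - dl, t[).
move=> /(measure_negligible mI).
have := lebesgue_measure_itv `]t - dl, t[ => /[swap] e; rewrite [LHS]e /=.
rewrite lte_fin ltrBlDr ltrDl dl0 -EFinD => -[] /esym/eqP.
by rewrite opprB addrC subrK gt_eqF.
Qed.

(* Main.v *)
Require Import Defs.
From mathcomp Require Import all_boot all_order all_algebra.
From mathcomp Require Import all_classical all_reals all_analysis.
From mathcomp Require Import measurable_realfun ring lra.
Import Order.TTheory GRing.Theory Num.Theory.
Import numFieldNormedType.Exports.
Local Open Scope classical_set_scope.
Local Open Scope ring_scope.

Set Implicit Arguments.
Unset Strict Implicit.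
Unset Printing Implicit Defensive.

(** Let M be the maximal invariant set and z the point where the curve x meets
    the boundary of the constraint set.  The proof rests on the invariance of M
    and on the fact that the dynamics do not depend on time.

    M is closed: trajectories depend continuously on their initial state, so
    the closure of a robustly invariant set is robustly invariant
    ([closure_RPI], [closure_MRPI]).  Hence x starts in M and stays in M.

    Let Phi be the fundamental matrix of the equation linearized along x, and
    for an active index i let
      lambda(t) = Phi(t)^-T Phi(tbar)^T (grad g_i(z))^T,
    the solution of the adjoint equation that ends at the gradient of g_i.
    Take y in M close to x(tau) and let the system run from y with the remaining
    piece of the disturbance.  The trajectory stays in M, so that g_i is
    nonpositive at its end; but to first order this end value is
    g_i(z) + lambda(tau)^T (y - x(tau)) ([flow_pullback]), and g_i(z) = 0.
    Therefore lambda(tau)^T v <= 0 for each direction v tangent to M at x(tau),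
    that is, such that M contains points x(tau) + h v + o(h) for all small h > 0
    ([costate_polar]).
    There are two kinds of such directions.  Running from x(tau) for a short
    time under a constant disturbance q gives v = f(x(tau), q)
    ([costate_nonpos]); restarting at the earlier point x(tau - h) gives, for almost every tau,
    v = - f(x(tau), dbar(tau)).  Together they say that the maximum of the
    Hamiltonian is 0 and is attained by dbar(tau) ([costate_stationary]).

    At tbar the first kind reads L_f g_i(z, q) <= 0.  Equality for
    q = dbar(tbar) follows from the equality at times close to tbar, along
    which dbar approaches the value dbar(tbar)
    ([costate_terminal_stationary]).  All this holds for every active index, so
    all the numbers L_f g_i(z, dbar(tbar)) vanish and any active index can be
    taken as i*.

    The analysis behind it uses absolutely continuous curves with derivatives
    almost everywhere, and no integral.  An absolutely continuous curve whose
    derivative is bounded by K almost everywhere is K-Lipschitz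
    ([ae_derive_lipschitz]); this yields the Gronwall estimate ([gronwall]) and
    through it all the perturbation estimates.  It also solves the linearized
    equation: the difference quotients of nearby trajectories differ from each
    other by curves with arbitrarily small Lipschitz constants, so that their
    limit has the limit of their derivatives as derivative almost everywhere
    ([variational_solution_limit]). *)

(** * Derivatives and absolutely continuous curves *)

(** The epsilon-delta form makes derivatives and Lipschitz estimates directly
    comparable. *)
Lemma is_derive1P {R : realType} {V : normedModType R} (x : R -> V) (t : R)
    (d : V) :
  is_derive t (1 : R) x d <->
  forall e, 0 < e -> exists2 eta, 0 < eta &
    forall s, `|s - t| < eta -> `|x s - x t - (s - t) *: d| <= e * `|s - t|.
Proof.
split=> [[dx <-] e e0|H].
  have /cvgrPdist_le /(_ _ e0) :
      (fun h => h^-1 *: (x (h *: 1 + t) - x t)) @ 0^' --> 'D_1 x t by exact: dx.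
  rewrite /dnbhs /within /= => /nbhs_ballP[eta /= eta0 H].
  exists eta => // s st; have [->|nst] := eqVneq s t.
    by rewrite !subrr scale0r subr0 !normr0 mulr0.
  have h0 : s - t != 0 by rewrite subr_eq0.
  have := H (s - t); rewrite /ball /= sub0r normrN => /(_ st h0).
  rewrite [_ *: 1]mulr1 subrK => le.
  rewrite -(ler_pM2l (x := `|s - t|^-1)); last by rewrite invr_gt0 normr_gt0.
  rewrite mulrCA mulVf ?normr_eq0// mulr1 -normfV -normrZ scalerBr scalerA.
  by rewrite mulVf// scale1r distrC.
have cv : (fun h => h^-1 *: (x (h *: 1 + t) - x t)) @ 0^' --> d.
  apply/cvgrPdist_le => e e0; have [eta eta0 He] := H e e0.
  rewrite /dnbhs /within /=; apply/nbhs_ballP; exists eta => // h /=.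
  rewrite /ball /= sub0r normrN => hlt h0.
  rewrite [_ *: 1]mulr1; have := He (h + t); rewrite addrK => /(_ hlt).
  rewrite -(ler_pM2l (x := `|h|^-1)); last by rewrite invr_gt0 normr_gt0.
  rewrite mulrCA mulVf ?normr_eq0// mulr1 -normfV -normrZ scalerBr scalerA.
  by rewrite mulVf// scale1r distrC.
by apply: DeriveDef; [apply/cvg_ex; exists d | exact: (cvg_lim _ cv)].
Qed.

(** Cousin's lemma: every point has a neighbourhood in which the intervals that
    straddle it satisfy P, and the supremum of the points reached from a cannot
    lie before b. *)
Lemma interval_induction {R : realType} (P : R -> R -> Prop) (a b : R) :
  a <= b ->
  (forall l m r, a <= l -> l <= m -> m <= r -> r <= b ->
    P l m -> P m r -> P l r) ->
  (forall t, a <= t -> t <= b -> exists2 eta, 0 < eta &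
    forall l r, a <= l -> l <= t -> t <= r -> r <= b ->
      t - eta < l -> r < t + eta -> P l r) ->
  P a b.
Proof.
move=> ab trans loc.
pose S := [set t | [/\ a <= t, t <= b & P a t]].
have Sa : S a.
  split => //; have [eta eta0 H] := loc a (lexx _) ab.
  by apply: H => //; rewrite ?ltrBlDr ltrDl.
have supS : has_sup S by split; [exists a | exists b => t []].
pose c := sup S.
have ac : a <= c by apply: ub_le_sup => //; case: supS.
have cb : c <= b by apply: ge_sup => [|t []]; [exists a|].
have [eta eta0 H] := loc c ac cb.
have [s [As sb Pas] cs] := sup_adherent eta0 supS.
have sc : s <= c by apply: ub_le_sup => //; case: supS.
have Pto r : c <= r -> r <= b -> r < c + eta -> P a r.
  move=> cr rb rce; apply: (trans a s r) => //.
    exact: le_trans cr.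
  by apply: H.
have [bc|bc] := ltP b (c + eta); first exact: Pto.
have r1 : c <= c + eta / 2 by rewrite lerDl divr_ge0// ltW.
have r2 : c + eta / 2 < c + eta by rewrite ltrD2l ltr_pdivrMr// mulr_natr mulr2n ltrDl.
have : c + eta / 2 <= c.
  apply: ub_le_sup; first by case: supS.
  split; [exact: le_trans r1| | exact: Pto (ltW (lt_le_trans r2 bc)) r2].
  exact: ltW (lt_le_trans r2 bc).
by rewrite gerDl leNgt divr_gt0.
Qed.

Section AbsoluteContinuity.
Context {R : realType} {V : normedModType R}.
Implicit Types (x y u : R -> V) (a b : R).

Lemma abs_continuousB a b x y :
  abs_continuous a b x -> abs_continuous a b y ->
  abs_continuous a b (fun t => x t - y t).
Proof.
move=> cx cy e e0; have e20 : 0 < e / 2 by rewrite divr_gt0.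
have [d1 d10 H1] := cx _ e20; have [d2 d20 H2] := cy _ e20.
exists (Num.min d1 d2) => [|N l r lr dis]; first by rewrite lt_min d10.
rewrite lt_min => /andP[s1 s2].
rewrite [ltRHS](splitr e).
apply: (le_lt_trans _ (ltrD (H1 _ _ _ lr dis s1) (H2 _ _ _ lr dis s2))).
rewrite -big_split /=; apply: ler_sum => k _.
have -> : x (r k) - y (r k) - (x (l k) - y (l k)) =
  (x (r k) - x (l k)) - (y (r k) - y (l k)).
  by rewrite !opprB addrACA [RHS]addrACA [- y _ + _]addrC.
exact: ler_normB.
Qed.

Lemma abs_continuousZ a b (c : R) x :
  abs_continuous a b x -> abs_continuous a b (fun t => c *: x t).
Proof.
move=> cx e e0; have c1 : 0 < `|c| + 1 by rewrite ltr_wpDl.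
have [d d0 H] := cx _ (divr_gt0 e0 c1).
exists d => // N l r lr dis sd.
have := H N l r lr dis sd; rewrite ltr_pdivlMr// => /(le_lt_trans _); apply.
rewrite mulr_suml; apply: ler_sum => k _.
by rewrite -scalerBr normrZ mulrC ler_wpM2l// lerDl.
Qed.

Lemma abs_continuousS a b a' b' x : a <= a' -> b' <= b ->
  abs_continuous a b x -> abs_continuous a' b' x.
Proof.
move=> aa bb cx e /cx[d d0 H]; exists d => // N l r lr; apply: H => k.
by have [? ? ?] := lr k; split => //; [exact: le_trans aa _|exact: le_trans bb].
Qed.

Lemma lipschitz_abs_continuous a b (K : R) x :
  (forall s t, a <= s -> s <= t -> t <= b -> `|x t - x s| <= K * (t - s)) ->
  abs_continuous a b x.
Proof.
move=> lip e e0; have c1 : 0 < `|K| + 1 by rewrite ltr_wpDl.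
exists (e / (`|K| + 1)) => [|N l r lr _]; first exact: divr_gt0.
rewrite ltr_pdivlMr// => /(le_lt_trans _); apply.
rewrite mulr_suml; apply: ler_sum => k _; have [al ll rb] := lr k.
apply: le_trans (lip _ _ al ll rb) _; rewrite mulrC ler_wpM2l ?subr_ge0//.
by apply: le_trans (ler_norm _) _; rewrite lerDl.
Qed.

Lemma abs_continuous_dist a b x : abs_continuous a b x ->
  forall e, 0 < e -> exists2 delta, 0 < delta &
    forall s t, a <= s -> s <= b -> a <= t -> t <= b ->
      `|s - t| < delta -> `|x s - x t| < e.
Proof.
move=> cx e /cx[d d0 H]; exists d => //.
suff W s t : a <= s -> s <= t -> t <= b -> t - s < d -> `|x t - x s| < e.
  move=> s t as_ sb at_ tb; have [st|/ltW ts] := leP s t.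
    by rewrite distrC ger0_norm ?subr_ge0// distrC; exact: W.
  by rewrite ger0_norm ?subr_ge0//; exact: W.
move=> as_ st tb sd; have := H 1 (fun=> s) (fun=> t).
rewrite !big_ord1; apply => // k k'; by rewrite !ord1.
Qed.

Lemma abs_continuous_continuous a b x : abs_continuous a b x ->
  {within `[a, b], continuous x}.
Proof.
move=> cx; apply/subspace_continuousP => t; rewrite /= in_itv/= => /andP[a_t tb].
apply/cvgrPdist_lt => e /(abs_continuous_dist cx)[d d0 H].
rewrite near_withinE; apply/nbhs_ballP; exists d => // s /= ts.
by rewrite in_itv/= => /andP[as_ sb]; apply: H.
Qed.

End AbsoluteContinuity.

Lemma negligible_open_cover {R : realType} (N : set R) (delta : R) :
  lebesgue_measure.-negligible N -> 0 < delta ->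
  exists U : set R,
    [/\ open U, N `<=` U & (lebesgue_measure U < delta%:E)%E].
Proof.
move=> [A [mA A0 NA]] d0.
have [|U [oU AU Ud]] := lebesgue_regularity_outer mA _ d0.
  by rewrite (_ : _ A = 0%E) ?ltry.
exists U; split => //; first exact: subset_trans AU.
have mU : measurable U by exact: open_measurable.
rewrite -(setDUK AU) measureU//; last by rewrite setDIK.
  by rewrite (_ : _ A = 0%E) ?add0e.
exact: measurableD.
Qed.

(** The two one-sided estimates add up because the interval contains t; for
    intervals that merely lie near t no such bound holds. *)
Lemma is_derive_straddle {R : realType} {V : normedModType R} (u : R -> V)
    (t K e : R) (v : V) :
  is_derive t (1 : R) u v -> `|v| <= K -> 0 < e ->
  exists2 eta, 0 < eta & forall l r, l <= t -> t <= r ->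
    t - eta < l -> r < t + eta -> `|u r - u l| <= (K + e) * (r - l).
Proof.
move=> /is_derive1P duv vK e0; have [eta eta0 Heta] := duv _ e0.
have near_t y : `|y - t| < eta -> `|u y - u t| <= (K + e) * `|y - t|.
  move=> yt; have := Heta y yt; rewrite mulrDl => le1.
  rewrite -[u y - u t](subrK ((y - t) *: v)) addrC.
  apply: le_trans (ler_normD _ _) _; rewrite lerD//.
  by rewrite normrZ mulrC ler_wpM2r.
exists eta => // l r lt_ tr tl rt.
have r1 : `|r - t| < eta by rewrite ger0_norm ?subr_ge0//; lra.
have l1 : `|l - t| < eta by rewrite ler0_norm ?subr_le0//; lra.
have -> : u r - u l = (u r - u t) - (u l - u t).
  by rewrite opprB addrA subrK.
apply: le_trans (ler_normB _ _) _.
apply: le_trans (lerD (near_t _ r1) (near_t _ l1)) _.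
rewrite ger0_norm ?subr_ge0// ler0_norm ?subr_le0//.
lra.
Qed.

Lemma derive_lipschitz {R : realType} {V : normedModType R} (a b K : R)
    (u : R -> V) :
  a <= b ->
  (forall t, a <= t -> t <= b ->
     exists2 v, is_derive t (1 : R) u v & `|v| <= K) ->
  `|u b - u a| <= K * (b - a).
Proof.
move=> ab du; apply/ler_addgt0Pr => e0 e00.
have ba0 : 0 <= b - a by rewrite subr_ge0.
pose e := e0 / (b - a + 1).
have e_gt0 : 0 < e by rewrite divr_gt0// ltr_wpDl.
have eb : e * (b - a) <= e0.
  by rewrite /e mulrAC ler_pdivrMr ?ltr_wpDl// (ler_wpM2l (ltW e00))// lerDl.
suff : `|u b - u a| <= (K + e) * (b - a) by lra.
apply: (interval_induction (P := fun l r => `|u r - u l| <= (K + e) * (r - l))).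
- by [].
- move=> l m r _ _ _ _ lm mr; rewrite (_ : u r - u l = (u r - u m) + (u m - u l)).
    by apply: le_trans (ler_normD _ _) _; lra.
  by rewrite addrA subrK.
- move=> t a_t tb; have [v duv vK] := du t a_t tb.
  have [eta eta0 H] := is_derive_straddle duv vK e_gt0.
  by exists eta => // l r _ lt_ tr _; exact: H.
Qed.

(** Cover the null set of bad points by an open set U of small measure.  Cousin's
    lemma cuts the interval into pieces on which the increment of u is
    controlled by its derivative and pieces inside U.  The latter are disjoint
    and of small total length, so absolute continuity makes their contribution
    small. *)
Lemma ae_derive_lipschitz {R : realType} {V : normedModType R} (a b K : R)
    (u : R -> V) :
  0 <= K -> a <= b -> abs_continuous a b u ->
  {ae lebesgue_measure, forall t : R, a <= t -> t <= b ->
     exists2 v, is_derive t (1 : R) u v & `|v| <= K} ->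
  `|u b - u a| <= K * (b - a).
Proof.
move=> K0 ab ACu aeu; apply/ler_addgt0Pr => e0 e00.
have ba0 : 0 <= b - a by rewrite subr_ge0.
pose e := e0 / (b - a + 1).
have e_gt0 : 0 < e by rewrite divr_gt0// ltr_wpDl.
have [delta delta0 Hdelta] := ACu _ e_gt0.
have [U [oO NO Odelta]] := negligible_open_cover aeu delta0.
have mO : measurable U by exact: open_measurable.
pose inside l r (q : R * R) := [&& l <= q.1, q.1 <= q.2 & q.2 <= r].
(* The list s collects the pieces inside U.  Measuring the part of U in the
   half-open interval makes the length bound additive. *)
pose P l r := exists s : seq (R * R),
  [/\ all (inside l r) s, pairwise (fun q q' : R * R => q.2 <= q'.1) s,
      ((\sum_(q <- s) (q.2 - q.1))%:E <= lebesgue_measure (U `&` `]l, r]))%E &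
      `|u r - u l| <= (K + e) * (r - l) + \sum_(q <- s) `|u q.2 - u q.1|].
have [s0 [s_in s_pw s_len s_u]] : P a b.
  apply: interval_induction => //.
  - move=> l m r al lm mr rb [s1 [in1 pw1 len1 u1]] [s2 [in2 pw2 len2 u2]].
    exists (s1 ++ s2); split.
    + rewrite all_cat; apply/andP; split; [move: in1|move: in2];
        apply: sub_all => q /and3P[q1 q2 q3]; apply/and3P; split => //.
        exact: le_trans mr.
      exact: le_trans q1.
    + rewrite pairwise_cat pw1 pw2 !andbT; apply/allrelP => q q' qs1 qs2.
      have /and3P[_ _ +] := allP in1 _ qs1; have /and3P[+ _ _] := allP in2 _ qs2.
      by move=> /[swap]; exact: le_trans.
    + rewrite big_cat/= EFinD; apply: le_trans (leeD len1 len2) _.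
      rewrite -measureU.
      * rewrite -setIUr (_ : `]l, m]%classic `|` `]m, r]%classic = `]l, r]%classic)//.
        by rewrite -itv_bndbnd_setU ?bnd_simp.
      * by apply: measurableI => //; exact: measurable_itv.
      * by apply: measurableI => //; exact: measurable_itv.
      * apply/seteqP; split => // t [[_ /=]]; rewrite in_itv/= => /andP[_ tm] [_].
        by rewrite /= in_itv/= ltNge tm.
    + rewrite big_cat/=; have -> : u r - u l = (u r - u m) + (u m - u l).
        by rewrite addrA subrK.
      apply: le_trans (ler_normD _ _) _; apply: le_trans (lerD u2 u1) _.
      by lra.
  - move=> t a_t tb; have [Ot|nOt] := pselect (U t).
      have /nbhs_ballP[eta /= eta0 sub] := open_nbhs_nbhs (conj oO Ot).
      exists eta => // l r al lt_ tr rb tl rt; exists [:: (l, r)]; split => /=.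
      + by rewrite /inside/= !lexx andbT (le_trans lt_).
      + by [].
      + rewrite big_seq1/= (_ : U `&` `]l, r] = `]l, r]%classic).
          rewrite lebesgue_measure_itv/= lte_fin.
          have [//|] := ltP l r; rewrite -subr_le0 lee_fin => //.
        apply/setIidPr => y /=; rewrite in_itv/= => /andP[ly yr]; apply: sub.
        by rewrite /ball/= distrC ltr_distlC; apply/andP; split; lra.
      + rewrite big_seq1/= lerDr mulr_ge0 ?subr_ge0 ?(le_trans lt_)//.
        by rewrite addr_ge0// ltW.
    have [v duv vK] : exists2 v, is_derive t (1 : R) u v & `|v| <= K.
      by apply: contrapT => nv; apply: nOt; apply: NO => /= /(_ a_t tb).
    have [eta eta0 Heta] := is_derive_straddle duv vK e_gt0.
    exists eta => // l r al lt_ tr rb tl rt; exists [::]; split => //.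
      by rewrite big_nil.
    by rewrite big_nil addr0 Heta.
have K' : (K + e) * (b - a) + e = K * (b - a) + e0.
  by rewrite /e; field; lra.
rewrite -K'; apply: le_trans s_u _; rewrite lerD2l ltW//.
have len_lt : \sum_(q <- s0) (q.2 - q.1) < delta.
  rewrite -lte_fin; apply: le_lt_trans s_len _; apply: le_lt_trans Odelta.
  by apply: le_measure; rewrite ?inE//; apply: measurableI => //; exact: measurable_itv.
pose z : R * R := (0, 0).
have := Hdelta (size s0) (fun k => (nth z s0 k).1) (fun k => (nth z s0 k).2).
rewrite (big_nth z) big_mkord in len_lt; rewrite (big_nth z) big_mkord; apply => //.
  by move=> k; have /and3P[] := allP s_in _ (mem_nth z (ltn_ord k)).
move=> k k'; rewrite neq_ltn => /orP[] kk'; [left|right].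
  by move/(pairwiseP z): s_pw; apply => //; rewrite inE.
by move/(pairwiseP z): s_pw; apply => //; rewrite inE.
Qed.

(** * The Gronwall estimate *)

(** The general instance applies once the real line is read as the measurable
    type that carries the Lebesgue measure. *)
#[local] Instance lebesgue_ae_filter {R : realType} :
  Filter (nbhs (almost_everywhere (@lebesgue_measure R))).
Proof. exact: (@ae_filter_ringOfSetsType _ (measurableTypeR R)). Qed.

Lemma ae_neq {R : realType} (a : R) :
  {ae lebesgue_measure, forall t : R, t != a}.
Proof.
exists [set a]; split => [||t /= /negP]; first exact: measurable_set1.
  exact: lebesgue_measure_set1.
by rewrite negbK => /eqP.
Qed.

Lemma ae_derive_dist {R : realType} {V : normedModType R} (a b K : R)
    (u : R -> V) :
  0 <= K -> abs_continuous a b u ->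
  {ae lebesgue_measure, forall t : R, a <= t -> t <= b ->
     exists2 v, is_derive t (1 : R) u v & `|v| <= K} ->
  forall s t, a <= s -> s <= b -> a <= t -> t <= b ->
    `|u t - u s| <= K * `|t - s|.
Proof.
move=> K0 ACu aeu.
suff W s t : a <= s -> s <= t -> t <= b -> `|u t - u s| <= K * (t - s).
  move=> s t as_ sb at_ tb; have [st|/ltW ts] := leP s t.
    by rewrite (ger0_norm (x := t - s)) ?subr_ge0//; exact: W.
  by rewrite distrC (distrC t) (ger0_norm (x := s - t)) ?subr_ge0//; exact: W.
move=> as_ st tb; apply: ae_derive_lipschitz => //.
  exact: abs_continuousS ACu.
apply: filterS aeu => y Hy sy yt; apply: Hy; first exact: le_trans sy.
exact: le_trans tb.
Qed.

Section Gronwall.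
Context {R : realType} {V : normedModType R}.

(** On so short an interval the maximum of `|u| absorbs the bound on the
    derivative: it is at most `|u s| plus half of itself and half of be.  The
    estimate holds in both directions of time. *)
Lemma gronwall_step (a b L h be : R) (u : R -> V) :
  0 <= L -> 0 <= be -> 0 <= h -> h <= 1 / 2 -> L * h <= 1 / 2 ->
  abs_continuous a b u ->
  {ae lebesgue_measure, forall t : R, a <= t -> t <= b ->
     exists2 v, is_derive t (1 : R) u v & `|v| <= L * `|u t| + be} ->
  forall s t, a <= s -> s <= b -> a <= t -> t <= b -> `|t - s| <= h ->
    `|u t| + be <= 2 * (`|u s| + be).
Proof.
move=> L0 be0 h0 h2 Lh ACu aeu s t as_ sb at_ tb tsh.
pose p := Num.min s t; pose q := Num.max s t.
have ps : p <= s by rewrite ge_min lexx.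
have pt : p <= t by rewrite ge_min lexx orbT.
have sq : s <= q by rewrite le_max lexx.
have tq : t <= q by rewrite le_max lexx orbT.
have ap : a <= p by rewrite le_min as_.
have qb : q <= b by rewrite ge_max sb.
have pqh : q - p <= h.
  move: tsh; rewrite /p /q; have [st|/ltW ts] := leP s t.
    by rewrite ger0_norm ?subr_ge0.
  by rewrite ler0_norm ?subr_le0// opprB.
have ACpq : abs_continuous p q u by exact: abs_continuousS ACu.
have cu : {within `[p, q], continuous (fun y => `|u y|)}.
  apply/subspace_continuousP => y y_in; apply: cvg_norm.
  by have /subspace_continuousP := abs_continuous_continuous ACpq; apply.
have [c] := EVT_max (le_trans ps sq) cu.
rewrite in_itv/= => /andP[pc cq] cmax.
pose M := `|u c|.
have uM y : p <= y -> y <= q -> `|u y| <= M.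
  by move=> py yq; apply: cmax; rewrite in_itv/= py.
have M0 : 0 <= M by exact: normr_ge0.
have K0 : 0 <= L * M + be by rewrite addr_ge0// mulr_ge0.
have : `|u c - u s| <= (L * M + be) * `|c - s|.
  apply: (ae_derive_dist K0 ACpq) => //.
  apply: filterS aeu => y Hy py yq.
  have [v dv vle] := Hy (le_trans ap py) (le_trans yq qb).
  by exists v => //; apply: le_trans vle _; rewrite lerD2r ler_wpM2l// uM.
have csh : `|c - s| <= h.
  by rewrite ler_distlC; apply/andP; split; lra.
move/le_trans/(_ (ler_wpM2l K0 csh)) => ucs.
have Mle : M <= `|u s| + (L * M + be) * h.
  rewrite /M -{1}[u c](subrK (u s)) addrC; apply: le_trans (ler_normD _ _) _.
  by rewrite lerD2l.
have e1 : L * M * h <= 1 / 2 * M by rewrite mulrAC ler_wpM2r.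
have e2 : be * h <= be * (1 / 2) by rewrite ler_wpM2l.
have := uM t pt tq; lra.
Qed.

(** Iterating the short step from s to t doubles the bound each time.  The
    constant depends only on L and on the length of the interval, and s may lie
    after t; both are essential below. *)
Lemma gronwall (L len : R) : 0 <= L -> 0 <= len ->
  exists2 C : R, 0 < C & forall (a b be : R) (u : R -> V),
    0 <= be -> b - a <= len -> abs_continuous a b u ->
    {ae lebesgue_measure, forall t : R, a <= t -> t <= b ->
       exists2 v, is_derive t (1 : R) u v & `|v| <= L * `|u t| + be} ->
    forall s t, a <= s -> s <= b -> a <= t -> t <= b ->
      `|u t| <= C * (`|u s| + be).
Proof.
move=> L0 len0; pose h := (2 * (L + 1))^-1.
have L1 : 0 < 2 * (L + 1) by lra.
have h0 : 0 < h by rewrite invr_gt0.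
have h2 : h <= 1 / 2 by rewrite /h div1r lef_pV2 ?posrE//; lra.
have Lh : L * h <= 1 / 2 by rewrite /h ler_pdivrMr//; lra.
pose N := Num.bound (len / h).
exists (2 ^+ N) => [|a b be u be0 bal ACu aeu s t as_ sb at_ tb].
  by rewrite exprn_gt0.
suff H k : forall s t, a <= s -> s <= b -> a <= t -> t <= b ->
    `|t - s| <= k%:R * h -> `|u t| + be <= 2 ^+ k * (`|u s| + be).
  apply: le_trans (H N s t as_ sb at_ tb _); first by rewrite lerDl.
  have tsl : `|t - s| <= len by rewrite ler_distlC; apply/andP; split; lra.
  apply: le_trans tsl _; rewrite -ler_pdivrMr//; apply/ltW/archi_boundP.
  by rewrite divr_ge0// ltW.
elim: k => [|k IH] {as_ sb at_ tb} s' t' as_ sb at_ tb.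
  by rewrite mul0r normr_le0 subr_eq0 => /eqP->; rewrite expr0 mul1r.
move=> tsk.
(* The point m lies at distance at most h from t' and leaves k steps to s'. *)
pose c : R := k%:R / k.+1%:R; pose m := s' + c * (t' - s').
have k1 : (0 : R) < k.+1%:R by rewrite ltr0n.
have c0 : 0 <= c by rewrite divr_ge0// ler0n.
have c1 : c <= 1 by rewrite ler_pdivrMr// mul1r ler_nat.
have c1E : 1 - c = k.+1%:R^-1.
  by rewrite /c -{1}(divff (lt0r_neq0 k1)) -mulrBl -natr1 addrAC subrr add0r mul1r.
have am : a <= m.
  rewrite (_ : m = (1 - c) * s' + c * t'); last by rewrite /m; ring.
  have := ler_wpM2l c0 at_; have := ler_wpM2l (_ : 0 <= 1 - c) as_; lra.
have mb : m <= b.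
  rewrite (_ : m = (1 - c) * s' + c * t'); last by rewrite /m; ring.
  have := ler_wpM2l c0 tb; have := ler_wpM2l (_ : 0 <= 1 - c) sb; lra.
have ms : `|m - s'| <= k%:R * h.
  rewrite /m addrAC subrr add0r normrM ger0_norm// /c mulrAC ler_pdivrMr//.
  by rewrite -mulrA ler_wpM2l// [h * _]mulrC.
have tm : `|t' - m| <= h.
  rewrite (_ : t' - m = (1 - c) * (t' - s')); last by rewrite /m; ring.
  by rewrite c1E normrM normfV (ger0_norm (ltW k1)) ler_pdivrMl.
have Hm := IH _ _ as_ sb am mb ms.
have := gronwall_step L0 be0 (ltW h0) h2 Lh ACu aeu am mb at_ tb tm.
by move=> /le_trans le1; apply: le1; rewrite exprS -mulrA ler_wpM2l.
Qed.

End Gronwall.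

(** * Norms of matrices and uniformity near compact sets *)

Section MatrixNorm.
Context {R : realType}.

Lemma mx_norm_entry {m n} (A : 'M[R]_(m, n)) i j : `|A i j| <= `|A|.
Proof.
rewrite [leRHS]/Num.norm/= mx_normrE.
exact: (le_bigmax _ (fun ij : 'I_m * 'I_n => `|A ij.1 ij.2|) (i, j)).
Qed.

Lemma mx_norm_le {m n} (A : 'M[R]_(m, n)) c :
  0 <= c -> (forall i j, `|A i j| <= c) -> `|A| <= c.
Proof.
move=> c0 H; rewrite [leLHS]/Num.norm/= mx_normrE.
by apply/bigmax_leP; split => // -[i j] _; exact: H.
Qed.

Lemma mx_norm_mulmx {m n k} (A : 'M[R]_(m, n)) (B : 'M[R]_(n, k)) :
  `|A *m B| <= n%:R * `|A| * `|B|.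
Proof.
apply: mx_norm_le => [|i j]; first by rewrite !mulr_ge0.
rewrite mxE; apply: le_trans (ler_norm_sum _ _ _) _.
rewrite -mulrA mulr_natl.
rewrite (_ : _ *+ n = \sum_(l < n) `|A| * `|B|); last first.
  by rewrite sumr_const card_ord.
by apply: ler_sum => l _; rewrite normrM ler_pM ?mx_norm_entry.
Qed.

Lemma mulmx_entry_norm {n : nat} (a : 'rV[R]_n) (v : 'cV[R]_n) :
  `|(a *m v) 0 0| <= n%:R * `|a| * `|v|.
Proof. exact: le_trans (mx_norm_entry _ _ _) (mx_norm_mulmx _ _). Qed.

Lemma mx_norm_trmx {m n} (A : 'M[R]_(m, n)) : `|A^T| <= `|A|.
Proof.
by apply: mx_norm_le => // i j; rewrite mxE mx_norm_entry.
Qed.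

Lemma mx_norm_delta {n} (j : 'I_n) : `|delta_mx j 0 : 'cV[R]_n| <= 1.
Proof.
apply: mx_norm_le => // i k; rewrite mxE.
by case: (_ && _); rewrite ?normr1 ?normr0.
Qed.

Lemma mx_norm_col_le {m n} (A : 'M[R]_(m, n)) (c : R) : 0 <= c ->
  (forall v : 'cV[R]_n, `|A *m v| <= c * `|v|) -> `|A| <= c.
Proof.
move=> c0 H; apply: mx_norm_le => // i j.
have -> : A i j = (A *m delta_mx j (0 : 'I_1)) i 0.
    rewrite mxE (bigD1 j)//= mxE !eqxx mulr1 big1 ?addr0// => k kj.
    by rewrite mxE (negPf kj) mulr0.
apply: le_trans (mx_norm_entry _ _ _) _; apply: le_trans (H _) _.
by rewrite ler_piMr// mx_norm_delta.
Qed.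

End MatrixNorm.

Section UniformContinuity.
Context {R : realType} {V P W : normedModType R}.
Variables (U D : set P) (K : set V) (h : V -> P -> W).
Hypotheses (DU : D `<=` U) (cD : compact D) (cK : compact K).
Hypothesis ch : jointly_continuous_on U h.

(** Unlike in the Heine-Cantor theorem, y may lie outside K. *)
Lemma jointly_continuous_near_compact (e : R) : 0 < e ->
  exists2 delta, 0 < delta & forall x q y, K x -> D q -> `|y - x| < delta ->
    `|h y q - h x q| < e.
Proof.
move=> e0; have /compact_near_coveringP cKD := compact_setX cK cD.
pose Q (d : R) (z : V * P) := forall y, `|y - z.1| < d ->
  `|h y z.2 - h z.1 z.2| < e.
have : \forall d \near 0^'+, K `*` D `<=` Q d.
  apply: cKD => -[x q] /= [Kx Dq].
  have /cvgrPdist_lt/(_ (e / 2)) := ch (x := x) (DU Dq).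
  rewrite divr_gt0// => /(_ isT)/nbhs_ballP[r /= r0 H].
  have r20 : 0 < r / 2 by rewrite divr_gt0.
  exists (ball (x, q) (r / 2), [set d | 0 < d /\ d < r / 2]) => /=.
    split; first exact: nbhsx_ballx.
    by near=> d; split; near: d; [exact: nbhs_right_gt|exact: nbhs_right_lt].
  move=> [[x' q'] d] /= [[/= xx' qq'] [d0 dr]] y yx'.
  have b1 : ball (x, q) r (x', q').
    by split; apply: le_ball (_ : r / 2 <= r) _ _; [lra| |lra|].
  have b2 : ball (x, q) r (y, q').
    split; last by apply: le_ball (_ : r / 2 <= r) _ _; [lra|].
    rewrite [r]splitr; apply: ball_triangle xx' _.
    by rewrite -ball_normE /ball_/= distrC (lt_trans yx').
  have := H _ b1; have := H _ b2; rewrite /= => h2 h1.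
  rewrite [ltRHS](splitr e) -[h y q'](subrK (h x q)) -addrA.
  apply: le_lt_trans (ler_normD _ _) _.
  by rewrite ltrD// distrC.
move=> /(filterI (nbhs_right_gt 0))/filter_ex[d [d0 Hd]].
by exists d => // x q y Kx Dq; exact: (Hd (x, q)).
Unshelve. all: by end_near. Qed.

Lemma jointly_continuous_bounded_compact :
  exists2 L, 0 <= L & forall x q, K x -> D q -> `|h x q| <= L.
Proof.
have /compact_near_coveringP cKD := compact_setX cK cD.
pose Q (L : R) (z : V * P) := `|h z.1 z.2| <= L.
have : \forall L \near +oo%R, K `*` D `<=` Q L.
  apply: cKD => -[x q] /= [Kx Dq].
  have /cvgrPdist_lt/(_ 1 ltr01)/nbhs_ballP[r /= r0 H] := ch (x := x) (DU Dq).
  exists (ball (x, q) r, [set L | `|h x q| + 1 < L]) => /=.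
    by split; [exact: nbhsx_ballx|exact: nbhs_pinfty_gt].
  move=> [[x' q'] L] /= [/H/= xx' qL]; rewrite /Q/=.
  apply/ltW/(le_lt_trans _ qL); rewrite -[h x' q'](subrK (h x q)) addrC.
  by apply: le_trans (ler_normD _ _) _; rewrite lerD2l ltW// distrC.
move=> /(filterI (nbhs_pinfty_gt (num_real 0)))/filter_ex[L [L0 HL]].
by exists L; [exact: ltW|move=> x q Kx Dq; exact: (HL (x, q))].
Qed.

End UniformContinuity.

(** * First-order expansions of functions of class C2 *)

Section Linearization.
Context {R : realType} {n : nat} {W : normedModType R}.
Implicit Types (F : 'cV[R]_n -> W) (x y : 'cV[R]_n).

Lemma derivable_line F x (e : 'cV[R]_n) (s : R) :
  derivable F (x + s *: e) e ->
  is_derive s (1 : R) (fun t : R => F (x + t *: e)) ('D_e F (x + s *: e)).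
Proof.
have E : (fun h : R => h^-1 *: (((fun t : R => F (x + t *: e)) \o shift s) (h *: 1)
    - F (x + s *: e))) =
  (fun h : R => h^-1 *: ((F \o shift (x + s *: e)) (h *: e) - F (x + s *: e))).
  apply/funext => h /=; congr (_ *: (F _ - _)).
  by rewrite [h *: 1]mulr1 scalerDl addrCA.
by move=> dF; apply: DeriveDef; rewrite /derivable /derive E.
Qed.

Lemma partial_mean_value F x (j : 'I_n) (c e : R) (v : W) :
  (forall s : R, `|s| <= `|c| -> derivable F (x + s *: delta_mx j 0) (delta_mx j 0) /\
    `|'D_(delta_mx j 0) F (x + s *: delta_mx j 0) - v| <= e) ->
  `|F (x + c *: delta_mx j 0) - F x - c *: v| <= e * `|c|.
Proof.
move=> H; pose u (s : R) := F (x + s *: delta_mx j 0) - s *: v.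
have du (s : R) : `|s| <= `|c| ->
    exists2 w, is_derive s (1 : R) u w & `|w| <= e.
  move=> sc; have [dF Fv] := H s sc.
  exists ('D_(delta_mx j 0) F (x + s *: delta_mx j 0) - v) => //.
  apply: is_deriveB; first exact: derivable_line.
  apply/is_derive1P => r r0; exists 1 => // t _.
  by rewrite scalerBl subrr normr0 mulr_ge0// ltW.
have -> : F (x + c *: delta_mx j 0) - F x - c *: v = u c - u 0.
  by rewrite /u !scale0r subr0 addr0 addrAC.
have [c0|/ltW c0] := leP 0 c.
  have := @derive_lipschitz _ _ 0 c e u c0; rewrite subr0 ger0_norm//; apply.
  by move=> t t0 tc; apply: du; rewrite !ger0_norm.
have := @derive_lipschitz _ _ c 0 e u c0; rewrite sub0r distrC ler0_norm//.
apply => t t0 tc; apply: du.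
by rewrite !ler0_norm// lerN2.
Qed.

(** Partial derivatives suffice: go from x to y along one coordinate at a time.
    The points in between stay as close to x as y because the norm is the
    maximum of the coordinates. *)
Lemma partials_linearization F x (r e : R) :
  0 <= e ->
  (forall y j, derivable F y (delta_mx j 0)) ->
  (forall y j, `|y - x| < r ->
     `|'D_(delta_mx j 0) F y - 'D_(delta_mx j 0) F x| <= e) ->
  forall y, `|y - x| < r ->
    `|F y - F x - \sum_j (y j 0 - x j 0) *: 'D_(delta_mx j 0) F x|
      <= n%:R * e * `|y - x|.
Proof.
move=> e0 dF HF y yx.
(* The first k coordinates of y followed by the remaining ones of x. *)
pose z (k : nat) : 'cV[R]_n := \col_i (if (i < k)%N then y i 0 else x i 0).
have z0 : z 0%N = x by apply/matrixP => i j; rewrite mxE ord1.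
have zn : z n = y by apply/matrixP => i j; rewrite mxE ord1 ltn_ord.
have zS (k : 'I_n) : z k.+1 = z k + (y k 0 - x k 0) *: delta_mx k 0.
  apply/matrixP => i j; rewrite ord1 !mxE ltnS leq_eqVlt eqxx andbT.
  have [->|ik] := eqVneq i k; first by rewrite eqxx ltnn mulr1 addrC subrK.
  by rewrite (_ : (i == k :> nat) = false) ?mulr0 ?addr0//; exact/negbTE.
have near_z (k : 'I_n) (s : R) : `|s| <= `|y k 0 - x k 0| ->
    `|z k + s *: delta_mx k 0 - x| <= `|y - x|.
  move=> sk; apply: mx_norm_le => // i j; rewrite ord1 !mxE eqxx andbT.
  have yxi : `|y i 0 - x i 0| <= `|y - x|.
    by have := mx_norm_entry (y - x) i 0; rewrite !mxE.
  have [->|ik] := eqVneq i k.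
    rewrite ltnn mulr1 addrAC subrr add0r; apply: le_trans sk _.
    by have := mx_norm_entry (y - x) k 0; rewrite !mxE.
  rewrite mulr0 addr0; case: ifP => _ //; by rewrite subrr normr0.
have -> : F y - F x = \sum_(k < n) (F (z k.+1) - F (z k)).
  rewrite -{1}zn -{1}z0 -(big_mkord xpredT (fun k => F (z k.+1) - F (z k))).
  by rewrite telescope_sumr.
rewrite -sumrB; apply: le_trans (ler_norm_sum _ _ _) _.
rewrite -mulrA mulr_natl.
rewrite (_ : _ *+ n = \sum_(l < n) e * `|y - x|); last first.
  by rewrite sumr_const card_ord.
apply: ler_sum => k _.
have yxk : `|y k 0 - x k 0| <= `|y - x|.
  by have := mx_norm_entry (y - x) k 0; rewrite !mxE.
apply: le_trans (ler_wpM2l e0 yxk); rewrite zS.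
apply: partial_mean_value => s sk; split; first exact: dF.
by apply: HF; apply: le_lt_trans yx; exact: near_z.
Qed.

End Linearization.

Lemma jacobian_mulE {R : realType} {n : nat} (F : 'cV[R]_n -> 'cV[R]_n)
    (x v : 'cV[R]_n) :
  jacobian_mx F x *m v = \sum_j v j 0 *: 'D_(delta_mx j 0) F x.
Proof.
apply/matrixP => i j; rewrite ord1 mxE summxE; apply: eq_bigr => l _.
by rewrite !mxE mulrC.
Qed.

Lemma grad_mulE {R : realType} {n : nat} (h : 'cV[R]_n -> R)
    (x v : 'cV[R]_n) :
  (grad h x *m v) 0 0 = \sum_j v j 0 *: 'D_(delta_mx j 0) h x.
Proof.
by rewrite mxE; apply: eq_bigr => l _; rewrite !mxE mulrC.
Qed.

Section LinearizationNearCompact.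
Context {R : realType} {n m : nat}.
Variables (U D : set 'cV[R]_m) (K : set 'cV[R]_n).
Variable f : 'cV[R]_n -> 'cV[R]_m -> 'cV[R]_n.
Hypotheses (DU : D `<=` U) (cD : compact D) (cK : compact K).
Hypothesis C2f : C2_in_fst U f.

Lemma jacobian_bounded_compact :
  exists2 L : R, 0 <= L & forall x q (v : 'cV[R]_n), K x -> D q ->
    `|jacobian_mx (f^~ q) x *m v| <= L * `|v|.
Proof.
case: C2f => _ _ cD1 _ _.
have /choice[L HL] : forall j : 'I_n, exists L, 0 <= L /\
    forall x q, K x -> D q -> `|'D_(delta_mx j 0) (f^~ q) x| <= L.
  move=> j; have [L L0 HL] :=
    jointly_continuous_bounded_compact DU cD cK (cD1 (delta_mx j 0)).
  by exists L.
exists (\sum_j L j) => [|x q v Kx Dq]; first by apply: sumr_ge0 => j _; case: (HL j).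
rewrite jacobian_mulE mulr_suml; apply: le_trans (ler_norm_sum _ _ _) _.
apply: ler_sum => j _; rewrite normrZ mulrC ler_pM ?mx_norm_entry//.
by have [_] := HL j; apply.
Qed.

(** The radius delta works for all base points in K and all parameters in D at
    once, which an estimate along a whole trajectory needs. *)
Lemma linearization_near_compact (e : R) : 0 < e ->
  exists2 delta, 0 < delta & forall x q y, K x -> D q -> `|y - x| < delta ->
    `|f y q - f x q - jacobian_mx (f^~ q) x *m (y - x)| <= e * `|y - x|.
Proof.
move=> e0; case: C2f => _ df cD1 _ _.
have n1 : (0 : R) < n%:R + 1 by rewrite ltr_wpDl ?ler0n.
pose e' := e / (n%:R + 1).
have e'0 : 0 < e' by rewrite divr_gt0.
have /choice[dl Hdl] : forall j : 'I_n, exists dl, 0 < dl /\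
    forall x q y, K x -> D q -> `|y - x| < dl ->
      `|'D_(delta_mx j 0) (f^~ q) y - 'D_(delta_mx j 0) (f^~ q) x| < e'.
  move=> j; have [dl dl0 H] :=
    jointly_continuous_near_compact DU cD cK (cD1 (delta_mx j 0)) e'0.
  by exists dl.
exists (\big[Num.min/1]_j dl j) => [|x q y Kx Dq yx].
  by apply: lt_bigmin => // j _; case: (Hdl j).
rewrite jacobian_mulE.
have le1 : n%:R * e' * `|y - x| <= e * `|y - x|.
  rewrite ler_wpM2r// /e' mulrCA ler_piMr ?(ltW e0)// ler_pdivrMr// mul1r.
  by rewrite lerDl.
apply: le_trans le1.
have := @partials_linearization R n _ (f^~ q) x _ e' (ltW e'0) _ _ y yx.
rewrite (eq_bigr (fun j => (y - x) j 0 *: 'D_(delta_mx j 0) (f^~ q) x)).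
  apply => [z j|z j zx]; first by apply: df; exact: DU.
  have [_ H] := Hdl j; apply/ltW/H => //; apply: lt_le_trans zx _.
  exact: bigmin_le.
by move=> j _; rewrite !mxE.
Qed.

End LinearizationNearCompact.

Lemma grad_linearization {R : realType} {n : nat} (h : 'cV[R]_n -> R) (e : R)
    (x : 'cV[R]_n) :
  C2 h -> 0 < e ->
  exists2 delta, 0 < delta & forall y, `|y - x| < delta ->
    `|h y - h x - (grad h x *m (y - x)) 0 0| <= e * `|y - x|.
Proof.
move=> [_ dh cD1 _ _] e0.
have n1 : (0 : R) < n%:R + 1 by rewrite ltr_wpDl ?ler0n.
pose e' := e / (n%:R + 1).
have e'0 : 0 < e' by rewrite divr_gt0.
have /choice[dl Hdl] : forall j : 'I_n, exists dl, 0 < dl /\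
    forall y, `|y - x| < dl ->
      `|'D_(delta_mx j 0) h y - 'D_(delta_mx j 0) h x| < e'.
  move=> j; have /cvgrPdist_lt/(_ _ e'0)/nbhs_ballP[dl /= dl0 H] :=
    cD1 (delta_mx j 0) x.
  exists dl; split => // y yx; rewrite distrC; apply: H.
  by rewrite -ball_normE /ball_/= distrC.
exists (\big[Num.min/1]_j dl j) => [|y yx].
  by apply: lt_bigmin => // j _; case: (Hdl j).
rewrite grad_mulE.
have le1 : n%:R * e' * `|y - x| <= e * `|y - x|.
  rewrite ler_wpM2r// /e' mulrCA ler_piMr ?(ltW e0)// ler_pdivrMr// mul1r.
  by rewrite lerDl.
apply: le_trans le1.
rewrite (eq_bigr (fun j => (y j 0 - x j 0) *: 'D_(delta_mx j 0) h x)); last first.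
  by move=> j _; rewrite !mxE.
apply: (@partials_linearization R n R h x _ e' (ltW e'0) _ _ y yx) => [z j|z j zx].
  exact: dh.
have [_ H] := Hdl j; apply/ltW/H => //; apply: lt_le_trans zx _.
exact: bigmin_le.
Qed.

(** * Translations in time *)

Section Translation.
Context {R : realType}.
Notation mu := (@lebesgue_measure R).

Lemma measurable_translation (s : R) (A : set R) :
  measurable A -> measurable [set t : R | A (t + s)].
Proof.
move=> mA; rewrite -[X in measurable X]setTI.
have : measurable_fun setT (fun t : R => t + s).
  by apply: measurable_funD => //; exact: measurable_cst.
by move=> /(_ measurableT _ mA).
Qed.

(** Both sides are measures that agree on intervals. *)
Lemma lebesgue_measure_translation (s : R) (A : set R) : measurable A ->
  mu [set t : R | A (t + s)] = mu A.
Proof.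
move=> mA; apply/esym.
have mf : @measurable_fun _ _ (measurableTypeR R) (measurableTypeR R) setT (fun t => t + s).
  by apply: measurable_funD => //; exact: measurable_cst.
pose f : {mfun (measurableTypeR R) >-> (measurableTypeR R)} :=
  @mfun_Sub _ _ (measurableTypeR R) (measurableTypeR R) _ (mem_set mf).
rewrite -[RHS]/(pushforward mu f A).
apply/lebesgue_measure_unique => //= _ [[a b]] _ <-.
rewrite /pushforward/=.
rewrite (_ : _ @^-1` _ = `]a - s, b - s]%classic).
  rewrite !lebesgue_measure_itv/= !lte_fin ltrD2r; case: ifP => // _.
  by rewrite -!EFinD; congr EFin; ring.
by apply/seteqP; split => t /=; rewrite !in_itv/= ltrBlDr lerBrDr.
Qed.

Lemma negligible_translation (s : R) (N : set R) :
  mu.-negligible N -> mu.-negligible [set t : R | N (t + s)].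
Proof.
move=> [A [mA A0 NA]]; exists [set t : R | A (t + s)]; split.
- exact: measurable_translation.
- by rewrite lebesgue_measure_translation.
- by move=> t /=; exact: NA.
Qed.

End Translation.

Section Shift.
Context {R : realType}.

Lemma abs_continuous_shift {V : normedModType R} (a b s : R) (x : R -> V) :
  abs_continuous (a + s) (b + s) x ->
  abs_continuous a b (fun t => x (t + s)).
Proof.
move=> cx e /cx[d d0 H]; exists d => // N l r lr dis lrd.
apply: (H N (fun k => l k + s) (fun k => r k + s)).
- by move=> k; have [? ? ?] := lr k; rewrite !lerD2r.
- by move=> k k' /dis; rewrite !lerD2r.
- by under eq_bigr do rewrite opprD addrACA subrr addr0.
Qed.

Lemma is_derive_shift {V : normedModType R} (x : R -> V) (t s : R) (v : V) :
  is_derive (t + s) (1 : R) x v ->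
  is_derive t (1 : R) (fun t => x (t + s)) v.
Proof.
move=> /is_derive1P dx; apply/is_derive1P => e /dx[d d0 H].
exists d => // r rt; have := H (r + s).
by rewrite opprD addrACA subrr addr0; apply.
Qed.

(** A forward shift keeps [t0, +oo[ inside the domain where x is a solution. *)
Lemma integral_curve_shift {n : nat} (t0 s : R)
    (F : R -> 'cV[R]_n -> 'cV[R]_n) (x : R -> 'cV[R]_n) :
  0 <= s -> integral_curve t0 F x ->
  integral_curve t0 (fun t => F (t + s)) (fun t => x (t + s)).
Proof.
move=> s0 [ACx dx]; split=> [b bt|].
  apply: abs_continuous_shift; apply: (@abs_continuousS _ _ t0 (b + s)) => //.
    by rewrite lerDl.
  by apply: ACx; rewrite (le_trans bt)// lerDl.
apply: negligibleS (negligible_translation s dx) => t /= nP P.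
by apply: nP => tt; apply: is_derive_shift; apply: P; rewrite (le_trans tt)// lerDl.
Qed.

(** A completed measurable set is a Borel set up to a null set, and both parts
    are stable under translation. *)
Lemma disturbances_shift {m : nat} (t0 s : R) (D : set 'cV[R]_m)
    (d : R -> 'cV[R]_m) :
  0 <= s -> disturbances t0 D d -> disturbances t0 D (fun t => d (t + s)).
Proof.
move=> s0 [Dd md]; split=> [t tt|j].
  by apply: Dd; rewrite (le_trans tt)// lerDl.
move=> mI Y mY.
have mI0 : @measurable _ (g_sigma_algebraType
    (completed_algebra_gen (@lebesgue_measure R))) `[t0, +oo[%classic.
  apply: sub_sigma_algebra; exists `[t0, +oo[%classic.
    exact: measurable_itv.
  by exists set0; [exact: negligible_set0|rewrite setU0].
have [A mA [N negN AN]] :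
    completed_algebra_gen (@lebesgue_measure R)
      (`[t0, +oo[ `&` (fun t => d t j 0) @^-1` Y).
  by rewrite -g_sigma_completed_algebra_genE; exact: (md j mI0 Y mY).
apply: sub_sigma_algebra; exists (`[t0, +oo[ `&` [set t | A (t + s)]).
  by apply: measurableI; [exact: measurable_itv|exact: measurable_translation].
exists (`[t0, +oo[ `&` [set t | N (t + s)]).
  by apply: negligibleS (negligible_translation s negN) => t [].
rewrite -setIUr (_ : _ `|` _ = [set t | (A `|` N) (t + s)])// AN.
apply/seteqP; split => t /=; rewrite !in_itv/= !andbT => -[tt H]; split => //.
  by case: H.
by split => //; rewrite (le_trans tt)// lerDl.
Qed.

End Shift.

(** * Perturbation of trajectories and the linearized equation *)

Section Perturbation.
Context {R : realType} {n m : nat}.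
Variables (t0 : R) (f : 'cV[R]_n -> 'cV[R]_m -> 'cV[R]_n).
Variables (U D : set 'cV[R]_m) (d : R -> 'cV[R]_m) (x : R -> 'cV[R]_n).
Hypotheses (DU : D `<=` U) (cD : compact D) (C2f : C2_in_fst U f).
Hypothesis Dd : forall t, t0 <= t -> D (d t).
Definition is_curve := integral_curve t0 (fun t y => f y (d t)).
Hypothesis cx : is_curve x.

Definition variational_field (t : R) (v : 'cV[R]_n) : 'cV[R]_n :=
  jacobian_mx (f^~ (d t)) (x t) *m v.

Let image_compact b : t0 <= b -> compact (x @` `[t0, b]).
Proof.
move=> tb; apply: continuous_compact; last exact: segment_compact.
by apply: abs_continuous_continuous; case: cx => acx _; exact: acx.
Qed.

Let image_mem b t : t0 <= t -> t <= b -> (x @` `[t0, b]) (x t).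
Proof. by move=> tt tb; exists t => //=; rewrite in_itv/= tt. Qed.

Lemma variational_field_bounded b : t0 <= b ->
  exists2 L : R, 0 <= L & forall t v, t0 <= t -> t <= b ->
    `|variational_field t v| <= L * `|v|.
Proof.
move=> tb.
have [L L0 H] := jacobian_bounded_compact DU cD (image_compact tb) C2f.
exists L => // t v tt tb'; apply: H; [exact: image_mem|exact: Dd].
Qed.

(** The linearization, hence the Gronwall estimate, is available only while y
    stays within d1 of x.  The estimate then keeps y at a distance
    C * `|y t0 - x t0| < d1, so that y cannot reach the distance d1; interval
    induction turns this into a statement about the whole interval. *)
Lemma curve_stability b : t0 <= b ->
  exists2 C : R, 0 < C & exists2 delta : R, 0 < delta &
    forall y, is_curve y -> `|y t0 - x t0| < delta ->
      forall t, t0 <= t -> t <= b -> `|y t - x t| <= C * `|y t0 - x t0|.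
Proof.
move=> tb; have [L L0 HL] := variational_field_bounded tb.
have [d1 d10 Hd1] := linearization_near_compact DU cD (image_compact tb) C2f ltr01.
have L10 : 0 <= L + 1 by lra.
have b0 : 0 <= b - t0 by rewrite subr_ge0.
have [C C0 gron] := @gronwall R 'cV[R]_n _ _ L10 b0.
exists C => //; exists (Num.min d1 (d1 / C)).
  by rewrite lt_min d10 divr_gt0.
move=> y cy; rewrite lt_min ltr_pdivlMr// [_ * C]mulrC => /andP[w0 Cw0].
pose w t := y t - x t.
have ACw c : t0 <= c -> abs_continuous t0 c w.
  by move=> tc; apply: abs_continuousB; [case: cy|case: cx] => acx _; exact: acx.
have bound c : t0 <= c -> c <= b ->
    (forall s, t0 <= s -> s <= c -> `|w s| < d1) ->
    forall s, t0 <= s -> s <= c -> `|w s| <= C * `|w t0|.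
  move=> tc cb wd1 s ts sc.
  have := gron t0 c 0 w (lexx _) _ (ACw c tc) _ t0 s (lexx _) tc ts sc.
  rewrite addr0; apply; first by rewrite lerD2r.
  apply: filterS2 cx.2 cy.2 => t dx dy tt tc'.
  exists (f (y t) (d t) - f (x t) (d t)).
    by apply: is_deriveB; [exact: dy|exact: dx].
  rewrite addr0 -[f (y t) _ - _](subrK (variational_field t (w t))).
  apply: le_trans (ler_normD _ _) _; rewrite mulrDl [leRHS]addrC.
  have tb' : t <= b by exact: le_trans cb.
  apply: lerD; last exact: HL.
  by apply: Hd1; [exact: image_mem|exact: Dd|exact: wd1].
have loc : forall s, t0 <= s -> s <= b -> `|w s| < d1.
  suff : (forall s, t0 <= s -> s <= t0 -> `|w s| < d1) ->
      forall s, t0 <= s -> s <= b -> `|w s| < d1.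
    apply => s ts st; have -> : s = t0 by apply/eqP; rewrite eq_le st.
    exact: w0.
  apply: (interval_induction (P := fun l r =>
    (forall s, t0 <= s -> s <= l -> `|w s| < d1) ->
    forall s, t0 <= s -> s <= r -> `|w s| < d1)) => //.
  - by move=> l k r _ _ _ _ lk kr /lk/kr.
  - move=> t tt tb'.
    have gap : 0 < d1 - C * `|w t0| by rewrite subr_gt0.
    have [eta eta0 Heta] := abs_continuous_dist (ACw b tb) gap.
    exists (eta / 2); first by rewrite divr_gt0.
    move=> l r tl lt_ tr rb le re wl s ts sr.
    have [sl|ls] := leP s l; first exact: wl.
    have lb : l <= b by lra.
    have wlC := bound l tl lb wl l tl (lexx _).
    have := Heta s l ts (le_trans sr rb) tl lb.
    rewrite ger0_norm ?subr_ge0 ?ltW// => /(_ _)/[dup] wsl.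
    have {}wsl : `|w s - w l| < d1 - C * `|w t0| by apply: wsl; lra.
    move=> _; rewrite -[w s](subrK (w l)).
    by apply: le_lt_trans (ler_normD _ _) _; lra.
by move=> t tt tb'; apply: (bound b tb (lexx _) loc).
Qed.

Lemma curve_residual b e : t0 <= b -> 0 < e ->
  exists2 delta : R, 0 < delta &
    forall y, is_curve y -> `|y t0 - x t0| < delta ->
      forall t, t0 <= t -> t <= b ->
        `|f (y t) (d t) - f (x t) (d t) - variational_field t (y t - x t)|
          <= e * `|y t0 - x t0|.
Proof.
move=> tb e0; have [C C0 [d1 d10 stab]] := curve_stability tb.
have [d2 d20 lin] := linearization_near_compact DU cD (image_compact tb) C2f
  (divr_gt0 e0 C0).
exists (Num.min d1 (d2 / C)) => [|y cy]; first by rewrite lt_min d10 divr_gt0.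
rewrite lt_min ltr_pdivlMr// [_ * C]mulrC => /andP[w1 w2] t tt tb'.
have yx := stab y cy w1 t tt tb'.
have := lin (x t) (d t) (y t) (image_mem tt tb') (Dd tt) (le_lt_trans yx w2).
move=> /le_trans; apply; rewrite mulrAC ler_pdivrMr// -mulrA ler_wpM2l ?(ltW e0)//.
by rewrite mulrC.
Qed.

(** The difference between y - x and q solves the linearized equation up to the
    residual of [curve_residual] and starts at 0. *)
Lemma curve_first_order b e : t0 <= b -> 0 < e ->
  exists2 delta : R, 0 < delta &
    forall y q, is_curve y -> integral_curve t0 variational_field q ->
      q t0 = y t0 - x t0 -> `|y t0 - x t0| < delta ->
      forall t, t0 <= t -> t <= b ->
        `|y t - x t - q t| <= e * `|y t0 - x t0|.
Proof.
move=> tb e0; have [L L0 HL] := variational_field_bounded tb.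
have b0 : 0 <= b - t0 by rewrite subr_ge0.
have [C C0 gron] := @gronwall R 'cV[R]_n _ _ L0 b0.
have [d1 d10 res] := curve_residual tb (divr_gt0 e0 C0).
exists d1 => // y q cy cq q0 w0 t tt tb'.
have be0 : 0 <= e / C * `|y t0 - x t0| by rewrite mulr_ge0// ltW ?divr_gt0.
have := gron t0 b _ (fun t => y t - x t - q t) be0 (lexx _) _ _ t0 t (lexx _) tb tt tb'.
rewrite q0 subrr normr0 add0r mulrA mulrCA divff ?gt_eqF// mulr1; apply.
  apply: abs_continuousB; last by case: cq => acx _; exact: acx.
  by apply: abs_continuousB; [case: cy|case: cx] => acx _; exact: acx.
apply: filterS (filterI cx.2 (filterI cy.2 cq.2)) => s [dx [dy dq]] ts sb.
exists (f (y s) (d s) - f (x s) (d s) - variational_field s (q s)).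
  by apply: is_deriveB; [apply: is_deriveB; [exact: dy|exact: dx]|exact: dq].
have -> : variational_field s (q s) =
    variational_field s (y s - x s) - variational_field s (y s - x s - q s).
  by rewrite /variational_field -mulmxBr opprB addrC subrK.
rewrite opprB addrCA; apply: le_trans (ler_normD _ _) _.
by apply: lerD; [exact: HL|exact: res].
Qed.

End Perturbation.

Section VariationalEquation.
Context {R : realType} {n m : nat}.
Variables (t0 : R) (f : 'cV[R]_n -> 'cV[R]_m -> 'cV[R]_n).
Variables (U D : set 'cV[R]_m) (d : R -> 'cV[R]_m) (x : R -> 'cV[R]_n).
Hypotheses (DU : D `<=` U) (cD : compact D) (C2f : C2_in_fst U f).
Hypothesis Dd : forall t, t0 <= t -> D (d t).
Hypothesis cx : is_curve t0 f d x.
Notation field := (variational_field f d x).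
Variables (v : 'cV[R]_n) (y : nat -> R -> 'cV[R]_n).
Hypothesis cy : forall k, is_curve t0 f d (y k).
Hypothesis y0 : forall k, y k t0 = x t0 + k.+1%:R^-1 *: v.

(* Difference quotients of the flow in the direction v, with step 1/(k+1). *)
Let q k t : 'cV[R]_n := k.+1%:R *: (y k t - x t).

Let q0 k : q k t0 = v.
Proof.
by rewrite /q y0 addrAC subrr add0r scalerA divff ?scale1r// pnatr_eq0.
Qed.

Let dq k t : 'cV[R]_n := k.+1%:R *: (f (y k t) (d t) - f (x t) (d t)).

Let ae_dq : {ae lebesgue_measure, forall t : R, t0 <= t ->
  forall k, is_derive t (1 : R) (q k) (dq k t)}.
Proof.
have : {ae lebesgue_measure, forall (t : R) k, t0 <= t ->
    is_derive t (1 : R) (y k) (f (y k t) (d t))}.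
  by apply: ae_foralln => k; exact: (cy k).2.
apply: filterS2 cx.2 => t dx dy tt k.
by apply: is_deriveZ; apply: is_deriveB; [exact: dy|exact: dx].
Qed.

Let acq b k : t0 <= b -> abs_continuous t0 b (q k).
Proof.
move=> tb; apply: abs_continuousZ; apply: abs_continuousB.
  by have [acx _] := cy k; exact: acx.
by have [acx _] := cx; exact: acx.
Qed.

Let dq_residual b e : t0 <= b -> 0 < e ->
  exists N, forall k, (N <= k)%N -> forall t, t0 <= t -> t <= b ->
    `|dq k t - field t (q k t)| <= e.
Proof.
move=> tb e0; have v1 : 0 < `|v| + 1 by rewrite ltr_wpDl.
have [delta delta0 res] := curve_residual DU cD C2f Dd cx tb (divr_gt0 e0 v1).
exists (Num.bound (`|v| / delta)) => k Nk t tt tb'.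
have k0 : (0 : R) < k.+1%:R by rewrite ltr0n.
have nk : `|y k t0 - x t0| = `|v| / k.+1%:R.
  by rewrite y0 addrAC subrr add0r normrZ normfV ger0_norm// mulrC.
have small : `|y k t0 - x t0| < delta.
  rewrite nk ltr_pdivrMr// -ltr_pdivrMl// mulrC.
  apply: (lt_le_trans (archi_boundP _)); first by rewrite divr_ge0// ltW.
  by rewrite ler_nat ltnW.
have := res _ (cy k) small t tt tb'.
rewrite -(ler_pM2l k0) -{1}(ger0_norm (ltW k0)) -normrZ scalerBr.
rewrite /variational_field scalemxAr => /le_trans; apply.
rewrite nk mulrCA [_ * (`|v| / _)]mulrC divfK ?gt_eqF//.
by rewrite mulrAC ler_pdivrMr// ler_wpM2l ?(ltW e0)// lerDl.
Qed.

(** The quotients form a Cauchy sequence in the Lipschitz norm, not only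
    uniformly: their derivatives differ by at most L times their distance plus
    the residuals.  This is what carries derivatives at a given time over to
    the limit. *)
Let q_cauchy b e : t0 <= b -> 0 < e ->
  exists N, forall k l, (N <= k)%N -> (N <= l)%N ->
    forall s t, t0 <= s -> s <= b -> t0 <= t -> t <= b ->
    `|(q k t - q l t) - (q k s - q l s)| <= e * `|t - s|.
Proof.
move=> tb e0; have [L L0 HL] := variational_field_bounded DU cD C2f Dd cx tb.
have b0 : 0 <= b - t0 by rewrite subr_ge0.
have [C C0 gron] := @gronwall R 'cV[R]_n _ _ L0 b0.
have LC : 0 < 2 * (L * C + 1) by rewrite mulr_gt0// ltr_wpDl// mulr_ge0// ltW.
pose e1 := e / (2 * (L * C + 1)).
have e10 : 0 < e1 by rewrite divr_gt0.
have [N HN] := dq_residual tb e10; exists N => k l Nk Nl.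
have be0 : 0 <= 2 * e1 by rewrite mulr_ge0// ltW.
have acu : abs_continuous t0 b (fun t => q k t - q l t).
  by apply: abs_continuousB; exact: acq.
have du : {ae lebesgue_measure, forall t : R, t0 <= t -> t <= b ->
    exists2 w, is_derive t (1 : R) (fun t => q k t - q l t) w &
      `|w| <= L * `|q k t - q l t| + 2 * e1}.
  apply: filterS ae_dq => t dqt tt tb'; exists (dq k t - dq l t).
    by apply: is_deriveB; exact: dqt.
  have -> : dq k t - dq l t = field t (q k t - q l t) +
      ((dq k t - field t (q k t)) - (dq l t - field t (q l t))).
    have -> : field t (q k t - q l t) = field t (q k t) - field t (q l t).
      exact: mulmxBr.
    by rewrite opprB addrACA [field t (q k t) + _]addrC subrK addKr.
  apply: le_trans (ler_normD _ _) _; apply: lerD; first exact: HL.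
  apply: le_trans (ler_normB _ _) _; rewrite mulr_natl mulr2n.
  by apply: lerD; exact: HN.
have bound t : t0 <= t -> t <= b -> `|q k t - q l t| <= C * (2 * e1).
  move=> tt tb'.
  have := gron t0 b _ _ be0 (lexx _) acu du t0 t (lexx _) tb tt tb'.
  by rewrite !q0 subrr normr0 add0r.
have K0 : 0 <= e by exact: ltW.
apply: (ae_derive_dist K0 acu); apply: filterS du => t H tt tb'.
have [w dw wle] := H tt tb'; exists w => //; apply: le_trans wle _.
have := ler_wpM2l L0 (bound t tt tb').
have -> : e = (L * C + 1) * (2 * e1) by rewrite /e1; field; rewrite gt_eqF//; lra.
lra.
Qed.

Let q_cvg t : t0 <= t -> cvg ((fun k => q k t) @ \oo).
Proof.
move=> tt; apply/cauchy_cvgP/cauchy_exP => e e0.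
have t1 : 0 < t - t0 + 1 by rewrite ltr_wpDl// subr_ge0.
have [N HN] := q_cauchy tt (divr_gt0 e0 t1).
exists (q N t); exists N => // k /= Nk; rewrite -ball_normE /=.
have := HN N k (leqnn N) Nk t0 t (lexx _) tt tt (lexx _).
rewrite !q0 subrr subr0 => /le_lt_trans; apply.
rewrite ger0_norm ?subr_ge0// mulrAC ltr_pdivrMr// ltr_pM2l//.
by rewrite ltrDl.
Qed.

Let qoo t : 'cV[R]_n := lim ((fun k => q k t) @ \oo).

Let q_limit b e : t0 <= b -> 0 < e ->
  exists N, forall k, (N <= k)%N ->
    forall s t, t0 <= s -> s <= b -> t0 <= t -> t <= b ->
    `|(q k t - qoo t) - (q k s - qoo s)| <= e * `|t - s|.
Proof.
move=> tb e0; have [N HN] := q_cauchy tb e0; exists N => k Nk s t ts sb tt tb'.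
have cv : (fun l => `|(q k t - q l t) - (q k s - q l s)|) @ \oo -->
    `|(q k t - qoo t) - (q k s - qoo s)|.
  apply: cvg_norm; apply: cvgB; apply: cvgB; try exact: cvg_cst; exact: q_cvg.
rewrite -(cvg_lim _ cv)//; apply: limr_le; first by apply/cvg_ex; eexists; exact: cv.
by exists N => // l /= Nl; exact: HN.
Qed.

Let acqoo b : t0 <= b -> abs_continuous t0 b qoo.
Proof.
move=> tb; have [N HN] := q_limit tb ltr01.
have -> : qoo = fun t => q N t - (q N t - qoo t).
  by apply/funext => t; rewrite opprB addrC subrK.
apply: abs_continuousB; first exact: acq.
apply: (@lipschitz_abs_continuous _ _ t0 b 1) => s t ts st tb'.
rewrite -[X in _ * X]ger0_norm ?subr_ge0//; apply: HN => //.
  exact: le_trans tb'.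
exact: le_trans st.
Qed.

(** The difference of the limit and q k has a small Lipschitz constant, so its
    difference quotients at t are small, whether or not it is differentiable
    there. *)
Let is_derive_qoo t : t0 < t -> (forall k, is_derive t (1 : R) (q k) (dq k t)) ->
  is_derive t (1 : R) qoo (field t (qoo t)).
Proof.
move=> t0t dqt; have tt := ltW t0t.
apply/is_derive1P => e e0; have e40 : 0 < e / 4 by rewrite divr_gt0.
have tb : t0 <= t + 1 by rewrite ler_wpDr.
have tt1 : t <= t + 1 by rewrite lerDl.
have [L L0 HL] := variational_field_bounded DU cD C2f Dd cx tb.
have L1 : 0 < L + 1 by rewrite ltr_wpDl.
have [N1 HN1] := q_limit tb e40.
have [N2 HN2] := dq_residual tb e40.
have /cvgrPdist_lt/(_ _ (divr_gt0 e40 L1))[N3 _ HN3] := q_cvg tt.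
pose k := maxn N1 (maxn N2 N3).
have k1 : (N1 <= k)%N by rewrite leq_maxl.
have k2 : (N2 <= k)%N by rewrite /k maxnCA leq_maxl.
have k3 : (N3 <= k)%N by rewrite /k maxnA leq_maxr.
have /is_derive1P/(_ _ e40)[eta eta0 Heta] := dqt k.
have close : `|dq k t - field t (qoo t)| <= e / 2.
  rewrite -[dq k t](subrK (field t (q k t))) -addrA.
  rewrite (_ : field t (q k t) - field t (qoo t) = field t (q k t - qoo t)).
    apply: le_trans (ler_normD _ _) _; rewrite (_ : e / 2 = e / 4 + e / 4).
      apply: lerD; first exact: HN2.
      apply: le_trans (HL _ _ tt tt1) _.
      have := HN3 k k3; rewrite /= distrC ltr_pdivlMr// => /ltW; apply: le_trans.
      by rewrite mulrC ler_wpM2l// lerDl.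
    by lra.
  exact/esym/mulmxBr.
exists (Num.min eta (Num.min 1 (t - t0))).
  by rewrite !lt_min eta0 ltr01 subr_gt0.
move=> s; rewrite !lt_min => /and3P[s1 s2 s3].
have ts : t0 <= s.
  by move: s3; rewrite ltr_distl => /andP[? _]; lra.
have sb : s <= t + 1.
  by move: s2; rewrite ltr_distl => /andP[_ ?]; lra.
have D1 := Heta s s1.
have D2 := HN1 k k1 t s tt tt1 ts sb.
have -> : qoo s - qoo t - (s - t) *: field t (qoo t) =
    (q k s - q k t - (s - t) *: dq k t) -
    ((q k s - qoo s) - (q k t - qoo t)) +
    (s - t) *: (dq k t - field t (qoo t)).
  rewrite scalerBr.
  have -> : q k s - qoo s - (q k t - qoo t) = (q k s - q k t) - (qoo s - qoo t).
    by rewrite !opprB addrACA [RHS]addrACA [- qoo s + _]addrC.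
  rewrite opprB [q k s - q k t - _ + _]addrC.
  by rewrite [X in _ = X + _]addrA subrK [RHS]addrA subrK.
apply: le_trans (ler_normD _ _) _.
apply: (le_trans (lerD (ler_normB _ _) (lexx _))).
rewrite normrZ.
have := ler_wpM2l (normr_ge0 (s - t)) close.
by lra.
Qed.

Lemma variational_solution_limit :
  exists2 z, integral_curve t0 field z & z t0 = v.
Proof.
exists qoo; last first.
  rewrite /qoo; under eq_fun do rewrite q0.
  exact: lim_cst.
split=> [b tb|]; first exact: acqoo.
apply: filterS2 (ae_neq t0) ae_dq => t nt H tt; apply: is_derive_qoo => //.
  by rewrite lt_neqAle eq_sym nt.
exact: H.
Qed.

End VariationalEquation.

(** * Fundamental matrices and the adjoint equation *)

Section LinearODE.
Context {R : realType} {n : nat}.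
Variables (t0 : R) (A : R -> 'M[R]_n).
Notation linear_curve := (integral_curve t0 (fun t v => A t *m v)).

Lemma linear_curve_sum (s : seq 'I_n) (a : 'I_n -> R) (z : 'I_n -> R -> 'cV[R]_n) :
  (forall j, linear_curve (z j)) ->
  linear_curve (fun t => \sum_(j <- s) a j *: z j t).
Proof.
move=> Hz; elim: s => [|j s [acy dy]].
  have -> : (fun t => \sum_(j <- [::]) a j *: z j t) = cst 0.
    by apply/funext => t; rewrite big_nil.
  split=> [b tb|].
    apply: (@lipschitz_abs_continuous _ _ t0 b 0) => *.
    by rewrite subrr normr0 mul0r.
  by apply: aeW => t _; rewrite mulmx0; exact: is_derive_cst.
have -> : (fun t => \sum_(j0 <- j :: s) a j0 *: z j0 t) =
    (fun t => \sum_(j0 <- s) a j0 *: z j0 t - (- a j) *: z j t).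
  by apply/funext => t; rewrite big_cons scaleNr opprK addrC.
have [acz dz] := Hz j; split=> [b tb|].
  by apply: abs_continuousB; [exact: acy|apply: abs_continuousZ; exact: acz].
apply: filterS2 dy dz => t dyt dzt tt; rewrite mulmxBr -scalemxAr.
by apply: is_deriveB; [exact: dyt|apply: is_deriveZ; exact: dzt].
Qed.

(** The columns of Phi are the solutions that start at the basis vectors. *)
Lemma fundamental_matrix :
  (forall v, exists2 z, linear_curve z & z t0 = v) ->
  exists2 Phi : R -> 'M[R]_n, Phi t0 = 1%:M &
    forall v, linear_curve (fun t => Phi t *m v).
Proof.
move=> H; have /choice[z Hz] : forall j : 'I_n, exists z,
    linear_curve z /\ z t0 = delta_mx j 0.
  by move=> j; have [z] := H (delta_mx j 0); exists z.
exists (fun t => \matrix_(i, j) z j t i 0).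
  by apply/matrixP => i j; rewrite !mxE (Hz j).2 mxE eqxx andbT.
move=> v; have := linear_curve_sum (index_enum 'I_n) (fun j => v j 0)
  (fun j => (Hz j).1).
congr (integral_curve t0 _ _); apply/funext => t.
apply/matrixP => i k; rewrite summxE mxE; apply: eq_bigr => j _.
by rewrite !mxE !ord1 mulrC.
Qed.

Hypothesis A_bounded : forall b, t0 <= b -> exists2 L : R, 0 <= L &
  forall t (v : 'cV[R]_n), t0 <= t -> t <= b -> `|A t *m v| <= L * `|v|.
Variable Phi : R -> 'M[R]_n.
Hypothesis Phi0 : Phi t0 = 1%:M.
Hypothesis Phi_curve : forall v, linear_curve (fun t => Phi t *m v).

(** The lower bound on Phi v is the Gronwall estimate backward in time. *)
Lemma fundamental_matrix_bounds b : t0 <= b -> exists2 C : R, 0 < C &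
  forall t (v : 'cV[R]_n), t0 <= t -> t <= b ->
    `|Phi t *m v| <= C * `|v| /\ `|v| <= C * `|Phi t *m v|.
Proof.
move=> tb; have [L L0 HL] := A_bounded tb.
have b0 : 0 <= b - t0 by rewrite subr_ge0.
have [C C0 gron] := @gronwall R 'cV[R]_n _ _ L0 b0.
exists C => // t v tt tb'; have [acP dP] := Phi_curve v.
have H s1 s2 : t0 <= s1 -> s1 <= b -> t0 <= s2 -> s2 <= b ->
    `|Phi s2 *m v| <= C * `|Phi s1 *m v|.
  move=> h1 h2 h3 h4.
  have := gron t0 b 0 _ (lexx _) (lexx _) (acP b tb) _ s1 s2 h1 h2 h3 h4.
  rewrite addr0; apply; apply: filterS dP => s ds ts sb.
  by exists (A s *m (Phi s *m v)); [exact: ds|rewrite addr0; exact: HL].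
have := H t0 t (lexx _) tb tt tb'; have := H t t0 tt tb' (lexx _) tb.
by rewrite Phi0 mul1mx.
Qed.

(** A solution that vanishes once vanishes at t0. *)
Lemma fundamental_matrix_unit t : t0 <= t -> Phi t \in unitmx.
Proof.
move=> tt; have [C C0 H] := fundamental_matrix_bounds tt.
rewrite -unitmx_tr unitmxE unitfE; apply/negP => /det0P[v v0 vP].
have [_] := H t v^T tt (lexx _).
have -> : Phi t *m v^T = 0 by rewrite -[LHS]trmxK trmx_mul trmxK vP trmx0.
by rewrite normr0 mulr0 normr_le0 -trmx0 (inj_eq trmx_inj) (negPf v0).
Qed.

Lemma fundamental_matrix_inv_bounded b : t0 <= b -> exists2 C : R, 0 < C &
  forall t, t0 <= t -> t <= b -> `|invmx (Phi t)| <= C.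
Proof.
move=> tb; have [C C0 H] := fundamental_matrix_bounds tb.
exists C => // t tt tb'; apply: mx_norm_col_le => [|v]; first exact: ltW.
have [_] := H t (invmx (Phi t) *m v) tt tb'.
by rewrite mulmxA mulmxV ?mul1mx// fundamental_matrix_unit.
Qed.

Lemma fundamental_matrix_lipschitz b : t0 <= b -> exists2 K : R, 0 <= K &
  forall s t, t0 <= s -> s <= b -> t0 <= t -> t <= b ->
    `|Phi t - Phi s| <= K * `|t - s|.
Proof.
move=> tb; have [L L0 HL] := A_bounded tb.
have [C C0 H] := fundamental_matrix_bounds tb.
have LC : 0 <= L * C by rewrite mulr_ge0// ltW.
exists (L * C) => // s t ts sb tt tb'.
apply: mx_norm_col_le => [|v]; first by rewrite mulr_ge0.
have [acP dP] := Phi_curve v; rewrite mulmxBl mulrAC.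
have K0 : 0 <= L * C * `|v| by rewrite mulr_ge0.
apply: (ae_derive_dist K0 (acP b tb)) => //.
apply: filterS dP => r dr tr rb; exists (A r *m (Phi r *m v)); first exact: dr.
apply: le_trans (HL _ _ tr rb) _; rewrite -mulrA ler_wpM2l//.
by have [] := H r v tr rb.
Qed.

Lemma invmxB s t : t0 <= s -> t0 <= t ->
  invmx (Phi t) - invmx (Phi s) =
    - (invmx (Phi t) *m (Phi t - Phi s) *m invmx (Phi s)).
Proof.
move=> ts tt; rewrite mulmxBr mulmxBl mulVmx ?fundamental_matrix_unit// mul1mx.
by rewrite -mulmxA mulmxV ?fundamental_matrix_unit// mulmx1 opprB.
Qed.

Lemma fundamental_matrix_inv_lipschitz b : t0 <= b -> exists2 K : R, 0 <= K &
  forall s t, t0 <= s -> s <= b -> t0 <= t -> t <= b ->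
    `|invmx (Phi t) - invmx (Phi s)| <= K * `|t - s|.
Proof.
move=> tb; have [C C0 HC] := fundamental_matrix_inv_bounded tb.
have [K K0 HK] := fundamental_matrix_lipschitz tb.
exists (n%:R * (n%:R * C * K) * C) => [|s t ts sb tt tb'].
  by rewrite !mulr_ge0// ltW.
rewrite invmxB// normrN; apply: le_trans (mx_norm_mulmx _ _) _.
have H1 := HC s ts sb; have H2 := HC t tt tb'; have H3 := HK s t ts sb tt tb'.
have H4 : `|invmx (Phi t) *m (Phi t - Phi s)| <= n%:R * C * K * `|t - s|.
  apply: le_trans (mx_norm_mulmx _ _) _.
  by rewrite -!mulrA ler_wpM2l// ler_pM.
have -> : n%:R * (n%:R * C * K) * C * `|t - s| =
    n%:R * (n%:R * C * K * `|t - s|) * C by ring.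
by rewrite ler_pM ?mulr_ge0// ler_wpM2l.
Qed.

Lemma ae_is_derive_fundamental_matrix :
  {ae lebesgue_measure, forall t : R, t0 <= t ->
     is_derive t (1 : R) Phi (A t *m Phi t)}.
Proof.
have : {ae lebesgue_measure, forall (t : R) (j : 'I_n), t0 <= t ->
    is_derive t (1 : R) (fun t => Phi t *m delta_mx j 0)
      (A t *m (Phi t *m delta_mx j (0 : 'I_1)))}.
  by apply: filter_forall => j; exact: (Phi_curve (delta_mx j 0)).2.
apply: filterS => t dt tt; apply/is_derive1P => e e0.
have /choice[eta Heta] : forall j : 'I_n, exists eta, 0 < eta /\
    forall s, `|s - t| < eta -> forall i,
      `|Phi s i j - Phi t i j - (s - t) * (A t *m Phi t) i j| <= e * `|s - t|.
  move=> j; have /is_derive1P/(_ e e0)[eta eta0 H] := dt j tt.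
  exists eta; split => // s st i; apply: le_trans (H s st).
  rewrite mulmxA -!colE; apply: le_trans (mx_norm_entry _ i 0).
  by rewrite !mxE.
exists (\big[Num.min/1]_j eta j) => [|s st].
  by apply: lt_bigmin => // j _; case: (Heta j).
apply: mx_norm_le => [|i j]; first by rewrite mulr_ge0// ltW.
have [_ /(_ s)] := Heta j; rewrite !mxE => /(_ _ i); rewrite !mxE; apply.
by apply: lt_le_trans st _; exact: bigmin_le.
Qed.

(** The derivative of an inverse, from
    inv(Phi s) - inv(Phi t) = - inv(Phi s) (Phi s - Phi t) inv(Phi t);
    boundedness and Lipschitz continuity of the inverse control the error. *)
Lemma is_derive_fundamental_matrix_inv t : t0 < t ->
  is_derive t (1 : R) Phi (A t *m Phi t) ->
  is_derive t (1 : R) (fun s => invmx (Phi s)) (- (invmx (Phi t) *m A t)).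
Proof.
move=> t0t /is_derive1P dP; have tt := ltW t0t.
have tb : t0 <= t + 1 by rewrite ler_wpDr.
have [C C0 HC] := fundamental_matrix_inv_bounded tb.
have [K K0 HK] := fundamental_matrix_inv_lipschitz tb.
apply/is_derive1P => e e0.
pose c1 : R := n%:R * (n%:R * C) * C; pose c2 : R := n%:R * K * `|A t|.
have c10 : 0 <= c1 by rewrite !mulr_ge0// ltW.
have c20 : 0 <= c2 by rewrite !mulr_ge0.
have c11 : 0 < 2 * (c1 + 1) by lra.
have c21 : 0 < 2 * (c2 + 1) by lra.
have [eta eta0 H] := dP _ (divr_gt0 e0 c11).
exists (Num.min (Num.min eta (e / (2 * (c2 + 1)))) (Num.min 1 (t - t0))).
  by rewrite !lt_min eta0 ltr01 subr_gt0 t0t divr_gt0.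
move=> s; rewrite !lt_min => /andP[/andP[s1 s2] /andP[s3 s4]].
have ts : t0 <= s by move: s4; rewrite ltr_distl => /andP[? _]; lra.
have sb : s <= t + 1 by move: s3; rewrite ltr_distl => /andP[_ ?]; lra.
have tb' : t <= t + 1 by rewrite lerDl.
have -> : invmx (Phi s) - invmx (Phi t) - (s - t) *: - (invmx (Phi t) *m A t) =
    - (invmx (Phi s) *m (Phi s - Phi t - (s - t) *: (A t *m Phi t)) *m invmx (Phi t))
    - (s - t) *: ((invmx (Phi s) - invmx (Phi t)) *m A t).
  have -> : invmx (Phi s) *m (Phi s - Phi t - (s - t) *: (A t *m Phi t)) *m
      invmx (Phi t) = invmx (Phi s) *m (Phi s - Phi t) *m invmx (Phi t) -
      (s - t) *: (invmx (Phi s) *m A t).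
    rewrite mulmxBr mulmxBl -scalemxAr -scalemxAl -!mulmxA.
    by rewrite mulmxV ?fundamental_matrix_unit// mulmx1.
  rewrite [in LHS]invmxB// scalerN opprK mulmxBl scalerBr !opprB.
  by rewrite [RHS]addrC addrA subrK addrC.
apply: le_trans (ler_normB _ _) _; rewrite normrN normrZ.
have e1 : `|invmx (Phi s) *m (Phi s - Phi t - (s - t) *: (A t *m Phi t)) *m
    invmx (Phi t)| <= e / 2 * `|s - t|.
  apply: le_trans (mx_norm_mulmx _ _) _.
  apply: (@le_trans _ _ (c1 * (e / (2 * (c1 + 1)) * `|s - t|))).
    have H1 := HC s ts sb; have H2 := HC t tt tb'; have H3 := H s s1.
    have -> : c1 * (e / (2 * (c1 + 1)) * `|s - t|) =
        n%:R * (n%:R * C * (e / (2 * (c1 + 1)) * `|s - t|)) * C.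
      by rewrite {1}/c1; ring.
    rewrite ler_pM ?mulr_ge0// ler_wpM2l//.
    apply: le_trans (mx_norm_mulmx _ _) _.
    by rewrite -mulrA -[leRHS]mulrA ler_wpM2l// ler_pM.
  rewrite mulrA ler_wpM2r// mulrA ler_pdivrMr//.
  lra.
have e2 : `|s - t| * `|(invmx (Phi s) - invmx (Phi t)) *m A t| <= e / 2 * `|s - t|.
  rewrite mulrC ler_wpM2r//; apply: le_trans (mx_norm_mulmx _ _) _.
  apply: (@le_trans _ _ (c2 * (e / (2 * (c2 + 1))))).
    have H1 := le_trans (HK t s tt tb' ts sb) (ler_wpM2l K0 (ltW s2)).
    have -> : c2 * (e / (2 * (c2 + 1))) =
        n%:R * (K * (e / (2 * (c2 + 1)))) * `|A t| by rewrite {1}/c2; ring.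
    by rewrite ler_wpM2r// ler_wpM2l.
  rewrite mulrA ler_pdivrMr//.
  lra.
lra.
Qed.

Lemma adjoint_linear_curve (mu : 'cV[R]_n) :
  integral_curve t0 (fun t l => - ((A t)^T *m l))
    (fun t => (invmx (Phi t))^T *m mu).
Proof.
split=> [b tb|].
  have [K K0 HK] := fundamental_matrix_inv_lipschitz tb.
  apply: (@lipschitz_abs_continuous _ _ t0 b (n%:R * K * `|mu|)) => s t ts st tb'.
  rewrite -mulmxBl -linearB/=; apply: le_trans (mx_norm_mulmx _ _) _.
  have -> : n%:R * K * `|mu| * (t - s) = n%:R * (K * (t - s)) * `|mu| by ring.
  rewrite ler_wpM2r// ler_wpM2l//; apply: le_trans (mx_norm_trmx _) _.
  rewrite -[X in _ * X]ger0_norm ?subr_ge0//; apply: HK => //.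
    exact: le_trans tb'.
  exact: le_trans st.
apply: filterS2 (ae_neq t0) ae_is_derive_fundamental_matrix => t nt dt tt.
have t0t : t0 < t by rewrite lt_neqAle eq_sym nt.
have /is_derive1P di := is_derive_fundamental_matrix_inv t0t (dt tt).
apply/is_derive1P => e e0.
have c0 : 0 < n%:R * `|mu| + 1 by rewrite ltr_wpDl// mulr_ge0.
have [eta eta0 H] := di _ (divr_gt0 e0 c0); exists eta => // s st.
have -> : (invmx (Phi s))^T *m mu - (invmx (Phi t))^T *m mu -
    (s - t) *: - ((A t)^T *m ((invmx (Phi t))^T *m mu)) =
    (invmx (Phi s) - invmx (Phi t) - (s - t) *: - (invmx (Phi t) *m A t))^T *m mu.
  by rewrite !scalerN !opprK !linearD/= linearN/= linearZ/= trmx_mul !mulmxDl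
    mulNmx -scalemxAl mulmxA.
apply: le_trans (mx_norm_mulmx _ _) _.
apply: (@le_trans _ _ (n%:R * (e / (n%:R * `|mu| + 1) * `|s - t|) * `|mu|)).
  by rewrite ler_wpM2r// ler_wpM2l// (le_trans (mx_norm_trmx _))// H.
have -> : n%:R * (e / (n%:R * `|mu| + 1) * `|s - t|) * `|mu| =
    e * (n%:R * `|mu|) / (n%:R * `|mu| + 1) * `|s - t| by ring.
by rewrite ler_wpM2r// ler_pdivrMr// ler_wpM2l ?(ltW e0)// lerDl.
Qed.

End LinearODE.

(** * Trajectories near a curve in an invariant set *)

Section Flow.
Context {R : realType} {n m : nat}.
Variables (t0 : R) (f : 'cV[R]_n -> 'cV[R]_m -> 'cV[R]_n).
Variables (U D : set 'cV[R]_m).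
Hypotheses (DU : D `<=` U) (cD : compact D) (C2f : C2_in_fst U f).
Hypothesis wp : well_posed t0 f D.

Lemma well_posed_ex d x0 : disturbances t0 D d ->
  exists2 y, is_curve t0 f d y & y t0 = x0.
Proof. by move=> /(wp x0)[y [[cy y0] _ _]]; exists y. Qed.

Lemma variational_solution d x v : disturbances t0 D d -> is_curve t0 f d x ->
  exists2 z, integral_curve t0 (variational_field f d x) z & z t0 = v.
Proof.
move=> dd cx.
have /choice[y Hy] : forall k : nat, exists y, is_curve t0 f d y /\
    y t0 = x t0 + k.+1%:R^-1 *: v.
  move=> k; have [y cy y0] := well_posed_ex (x t0 + k.+1%:R^-1 *: v) dd.
  by exists y.
exact: (variational_solution_limit DU cD C2f dd.1 cx
  (fun k => (Hy k).1) (fun k => (Hy k).2)).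
Qed.

(** A trajectory from a limit point of M is a limit of trajectories from M under
    the same disturbance. *)
Lemma closure_RPI M : RPI t0 f D M -> RPI t0 f D (closure M).
Proof.
move=> rpi x0 d x Mx0 dd [cx x0E] t tt B /nbhs_ballP[r /= r0 rB].
have [C C0 [delta delta0 stab]] := curve_stability DU cD C2f dd.1 cx tt.
have e0 : 0 < Num.min delta (r / C) by rewrite lt_min delta0 divr_gt0.
have [y0 [My0]] := Mx0 _ (nbhsx_ballx _ _ e0).
rewrite -ball_normE /ball_/= distrC lt_min => /andP[y1 y2].
have [y cy yE] := well_posed_ex y0 dd.
exists (y t); split; first exact: (rpi y0 d).
apply: rB; rewrite -ball_normE /ball_/= distrC.
apply: (@le_lt_trans _ _ (C * `|y t0 - x t0|)); first by apply: stab => //; rewrite yE x0E.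
by rewrite yE x0E mulrC -ltr_pdivlMr.
Qed.

(** With a constant disturbance the right-hand side is continuous along the
    curve, so the derivative exists on the right at t0. *)
Lemma constant_flow_expansion q y e : D q -> is_curve t0 f (fun=> q) y -> 0 < e ->
  exists2 eta, 0 < eta & forall h, 0 < h -> h < eta ->
    `|y (t0 + h) - y t0 - h *: f (y t0) q| <= e * h.
Proof.
move=> Dq [acy dy] e0; have [cf _ _ _ _] := C2f.
have /cvgrPdist_lt/(_ _ e0)/nbhs_ballP[r /= r0 Hr] := cf (y t0) q (DU Dq).
have t01 : t0 <= t0 + 1 by rewrite lerDl.
have [eta eta0 Heta] := abs_continuous_dist (acy _ t01) r0.
exists (Num.min 1 eta) => [|h h0]; first by rewrite lt_min ltr01.
rewrite lt_min => /andP[h1 heta].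
pose u t := y t - (t - t0) *: f (y t0) q.
have -> : y (t0 + h) - y t0 - h *: f (y t0) q = u (t0 + h) - u t0.
  by rewrite /u subrr scale0r subr0 [t0 + h]addrC addrK addrAC.
have th : t0 <= t0 + h by rewrite lerDl ltW.
have acu : abs_continuous t0 (t0 + h) u.
  apply: abs_continuousB; first exact: acy.
  apply: (@lipschitz_abs_continuous _ _ _ _ `|f (y t0) q|) => s t ts st tb.
  by rewrite -scalerBl normrZ mulrC opprB addrA subrK ger0_norm ?subr_ge0.
have -> : e * h = e * `|t0 + h - t0| by rewrite addrAC subrr add0r gtr0_norm.
apply: (ae_derive_dist (ltW e0) acu) => //.
apply: filterS dy => t dyt tt tb; exists (f (y t) q - f (y t0) q).
  apply: is_deriveB; first exact: dyt.
  apply/is_derive1P => r' r'0; exists 1 => // s _.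
  by rewrite -!scalerBl opprB addrA subrK subrr scale0r normr0 mulr_ge0 ?(ltW r'0).
rewrite distrC; apply/ltW; apply: (Hr (y t, q)); split => /=; last exact: ballxx.
rewrite -ball_normE /ball_/=; apply: Heta => //; first by lra.
by rewrite ler0_norm ?subr_le0//; lra.
Qed.

Section Pullback.
Variables (d : R -> 'cV[R]_m) (x : R -> 'cV[R]_n).
Hypotheses (dd : disturbances t0 D d) (cx : is_curve t0 f d x).
Notation A t := (jacobian_mx (f^~ (d t)) (x t)).
Variable Phi : R -> 'M[R]_n.
Hypothesis Phi0 : Phi t0 = 1%:M.
Hypothesis Phi_curve :
  forall v, integral_curve t0 (fun t v => A t *m v) (fun t => Phi t *m v).

Let A_bounded := variational_field_bounded DU cD C2f dd.1 cx.

Variables (h : 'cV[R]_n -> R) (tbar : R).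
Hypothesis C2h : C2 h.

(** The solution of the adjoint equation that equals the transposed gradient of
    h at time tbar. *)
Definition costate tau : 'cV[R]_n :=
  (invmx (Phi tau))^T *m ((Phi tbar)^T *m (grad h (x tbar))^T).

Lemma costate_mulE tau (v : 'cV[R]_n) :
  (costate tau)^T *m v = grad h (x tbar) *m (Phi tbar *m (invmx (Phi tau) *m v)).
Proof. by rewrite /costate !trmx_mul !trmxK !mulmxA. Qed.

(** The covector (costate tau)^T is the derivative at x tau of the map that
    sends a state at time tau to the value of h at time tbar, the remaining
    disturbance being kept.  Since curves start at t0, the remaining motion is
    shifted to begin there. *)
Lemma flow_pullback tau e : t0 <= tau -> tau <= tbar -> 0 < e ->
  exists2 delta, 0 < delta & forall y,
    is_curve t0 f (fun t => d (t + (tau - t0))) y -> `|y t0 - x tau| < delta ->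
    `|h (y (tbar - (tau - t0))) - h (x tbar) -
      ((costate tau)^T *m (y t0 - x tau)) 0 0| <= e * `|y t0 - x tau|.
Proof.
move=> ttau taub e0; set s := tau - t0; set b := tbar - s.
have s0 : 0 <= s by rewrite subr_ge0.
have tb : t0 <= b by rewrite /b /s; lra.
have ts : t0 + s = tau by rewrite /s addrC subrK.
have bs : b + s = tbar by rewrite /b subrK.
have dds := disturbances_shift s0 dd.
have cxs : is_curve t0 f (fun t => d (t + s)) (fun t => x (t + s)).
  exact: (integral_curve_shift s0 cx).
pose c := n%:R * `|grad h (x tbar)|.
have c0 : 0 <= c by rewrite mulr_ge0.
have c1 : 0 < 2 * (c + 1) by lra.
have [C C0 [d1 d10 stab]] := curve_stability DU cD C2f dds.1 cxs tb.
have [d2 d20 first] := curve_first_order DU cD C2f dds.1 cxs tb (divr_gt0 e0 c1).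
have C2 : 0 < 2 * C by rewrite mulr_gt0.
have [d3 d30 lin] := grad_linearization (x tbar) C2h (divr_gt0 e0 C2).
exists (Num.min d1 (Num.min d2 (d3 / C))).
  by rewrite !lt_min d10 d20 divr_gt0.
move=> y cy; rewrite !lt_min => /and3P[w1 w2 w3]; set w := y t0 - x tau.
(* The shifted solution of the linearized equation with value w at time t0. *)
pose q t := Phi (t + s) *m (invmx (Phi tau) *m w).
have cq : integral_curve t0
    (variational_field f (fun t => d (t + s)) (fun t => x (t + s))) q.
  exact: (integral_curve_shift s0 (Phi_curve (invmx (Phi tau) *m w))).
have q0 : q t0 = y t0 - x (t0 + s).
  rewrite /q ts mulmxA mulmxV ?mul1mx//.
  exact: (fundamental_matrix_unit A_bounded Phi0 Phi_curve).
have := stab y cy; have := first y q cy cq q0; rewrite ts -/w.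
move=> /(_ w2 b tb (lexx _)) + /(_ w1 b tb (lexx _)); rewrite bs => H1 H2.
have yz : `|y b - x tbar| < d3.
  by apply: le_lt_trans H2 _; rewrite mulrC -ltr_pdivlMr.
have H3 := lin _ yz.
have -> : h (y b) - h (x tbar) - ((costate tau)^T *m w) 0 0 =
    (h (y b) - h (x tbar) - (grad h (x tbar) *m (y b - x tbar)) 0 0) +
    (grad h (x tbar) *m (y b - x tbar - q b)) 0 0.
  have -> : (grad h (x tbar) *m (y b - x tbar - q b)) 0 0 =
      (grad h (x tbar) *m (y b - x tbar)) 0 0 - (grad h (x tbar) *m q b) 0 0.
    by rewrite (mulmxBr _ (y b - x tbar)) !mxE.
  by rewrite costate_mulE /q bs addrA subrK.
apply: le_trans (ler_normD _ _) _.
have H4 : e / (2 * C) * `|y b - x tbar| <= e / 2 * `|w|.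
  apply: le_trans (ler_wpM2l (ltW (divr_gt0 e0 C2)) H2) _.
  rewrite (_ : e / (2 * C) * (C * `|w|) = e / 2 * `|w|)//.
  by field; rewrite gt_eqF.
have H5 : `|(grad h (x tbar) *m (y b - x tbar - q b)) 0 0| <= e / 2 * `|w|.
  apply: le_trans (mulmx_entry_norm _ _) _; rewrite -/c.
  apply: le_trans (ler_wpM2l c0 H1) _.
  rewrite mulrA ler_wpM2r// mulrA ler_pdivrMr//; lra.
have := lerD (le_trans H3 H4) H5; lra.
Qed.

Variable M : set 'cV[R]_n.
Hypotheses (rpi : RPI t0 f D M) (Mh : forall y, M y -> h y <= 0).
Hypothesis hz : h (x tbar) = 0.

(** The hypothesis says that v is tangent to M at x tau.  The points y of M
    reach states with h <= 0 at time tbar, where h vanishes on the curve x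
    itself; so the first-order change of h cannot be positive. *)
Lemma costate_polar tau v : t0 <= tau -> tau <= tbar ->
  (forall e, 0 < e -> exists2 eta, 0 < eta & forall k, 0 < k -> k < eta ->
    exists2 y, M y & `|y - x tau - k *: v| <= e * k) ->
  ((costate tau)^T *m v) 0 0 <= 0.
Proof.
move=> ttau taub cont; rewrite leNgt; apply/negP => kappa0.
set kappa := (X in 0 < X) in kappa0.
pose l := n%:R * `|(costate tau)^T|.
have l0 : 0 <= l by rewrite mulr_ge0.
have v1 : 0 < `|v| + 1 by rewrite ltr_wpDl.
have e10 : 0 < kappa / (4 * (`|v| + 1)) by rewrite divr_gt0// mulr_gt0.
(* Each of the two errors is to cost at most a quarter of kappa. *)
have e20 : 0 < Num.min 1 (kappa / (4 * (l + 1))).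
  by rewrite lt_min ltr01 divr_gt0// mulr_gt0// ltr_wpDl.
have [delta delta0 pull] := flow_pullback ttau taub e10.
have [eta eta0 Heta] := cont _ e20.
pose k := Num.min (eta / 2) (delta / (2 * (`|v| + 1))).
have k0 : 0 < k by rewrite lt_min !divr_gt0// mulr_gt0.
have keta : k < eta by rewrite gt_min ltr_pdivrMr// ltr_pMr// ltr1n.
have [y0 My0 y0k] := Heta k k0 keta.
set w := y0 - x tau in y0k.
have [E1 E2] : `|w - k *: v| <= k /\ `|w - k *: v| <= kappa / (4 * (l + 1)) * k.
  split; apply: le_trans y0k _; rewrite ?ler_piMl ?ler_wpM2r ?(ltW k0)//.
    by rewrite ge_min lexx.
  by rewrite ge_min lexx orbT.
have wk : `|w| <= k * (`|v| + 1).
  rewrite -(subrK (k *: v) w); apply: le_trans (ler_normD _ _) _.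
  by rewrite normrZ (gtr0_norm k0); lra.
have wdelta : `|w| < delta.
  apply: le_lt_trans wk _; apply: (@le_lt_trans _ _ (delta / 2)).
    rewrite -ler_pdivlMr//; apply: (@le_trans _ _ (delta / (2 * (`|v| + 1)))).
      by rewrite /k ge_min lexx orbT.
    by rewrite invfM mulrA.
  by rewrite ltr_pdivrMr// ltr_pMr// ltr1n.
have s0 : 0 <= tau - t0 by rewrite subr_ge0.
have dds := disturbances_shift s0 dd.
have [y cy yE] := well_posed_ex y0 dds.
have := pull y cy; rewrite yE -/w hz subr0 => /(_ wdelta) pw.
have tb : t0 <= tbar - (tau - t0) by lra.
have hy : h (y (tbar - (tau - t0))) <= 0 by apply/Mh/(rpi My0 dds).
have lw : ((costate tau)^T *m w) 0 0 <= kappa / 4 * k.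
  have P1 : kappa / (4 * (`|v| + 1)) * `|w| <= kappa / 4 * k.
    apply: le_trans (ler_wpM2l (ltW e10) wk) _.
    rewrite (_ : _ * (k * _) = kappa / 4 * k)//.
    by field; rewrite gt_eqF.
  have := ler_norm (- (h (y (tbar - (tau - t0))) - ((costate tau)^T *m w) 0 0)).
  rewrite normrN; lra.
have lwk : `|((costate tau)^T *m (w - k *: v)) 0 0| <= kappa / 4 * k.
  apply: le_trans (mulmx_entry_norm _ _) _; rewrite -/l.
  apply: le_trans (ler_wpM2l l0 E2) _.
  rewrite mulrA ler_wpM2r ?(ltW k0)// mulrA ler_pdivrMr ?mulr_gt0 ?ltr_wpDl//.
  lra.
have E : ((costate tau)^T *m (w - k *: v)) 0 0 = ((costate tau)^T *m w) 0 0 - k * kappa.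
  by rewrite /kappa mulmxBr -scalemxAr !mxE.
have := ler_norm (- ((costate tau)^T *m (w - k *: v)) 0 0).
rewrite normrN; move: lwk; rewrite E; have := mulr_gt0 k0 kappa0; lra.
Qed.

Hypothesis Mx : forall t, t0 <= t -> M (x t).

(** A curve that first spends a short time near x tau under the disturbance q
    remains in M. *)
Lemma costate_nonpos tau q : t0 <= tau -> tau <= tbar -> D q ->
  ((costate tau)^T *m f (x tau) q) 0 0 <= 0.
Proof.
move=> ttau taub Dq; apply: costate_polar => // e e0.
have dq : disturbances t0 D (fun=> q).
  by split=> // j; exact: measurable_cst.
have [y cy y0] := well_posed_ex (x tau) dq.
have [eta eta0 H] := constant_flow_expansion Dq cy e0.
exists eta => // k k0 keta; exists (y (t0 + k)); last by rewrite -y0 H.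
apply: (rpi (Mx ttau) dq) => //; by rewrite lerDl ltW.
Qed.

(** Where x is differentiable, the earlier points x (t - k) of the curve show
    that the opposite velocity is tangent to M. *)
Lemma costate_stationary : {ae lebesgue_measure, forall t : R, t0 <= t ->
  t <= tbar -> ((costate t)^T *m f (x t) (d t)) 0 0 = 0}.
Proof.
apply: filterS2 (ae_neq t0) cx.2 => t nt dx tt tb.
have t0t : t0 < t by rewrite lt_neqAle eq_sym nt.
have Dt := dd.1 t tt; apply/eqP; rewrite eq_le costate_nonpos//=.
suff : ((costate t)^T *m - f (x t) (d t)) 0 0 <= 0.
  by rewrite mulmxN [leLHS]mxE oppr_le0.
apply: costate_polar => // e e0.
have /is_derive1P/(_ _ e0)[eta eta0 H] := dx tt.
exists (Num.min eta (t - t0)) => [|k k0]; first by rewrite lt_min eta0 subr_gt0.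
rewrite lt_min => /andP[keta kt].
exists (x (t - k)); first by apply: Mx; lra.
have E : t - k - t = - k by rewrite addrAC subrr add0r.
have := H (t - k); rewrite E normrN gtr0_norm// scalerN scaleNr.
by move=> /(_ keta).
Qed.

Lemma costate_terminal : t0 <= tbar -> (costate tbar)^T = grad h (x tbar).
Proof.
move=> tb; rewrite /costate !trmx_mul !trmxK -mulmxA mulmxV ?mulmx1//.
exact: (fundamental_matrix_unit A_bounded Phi0 Phi_curve).
Qed.

Lemma costate_adjoint : adjoint_curve t0 f d x costate.
Proof. exact: (adjoint_linear_curve A_bounded Phi0 Phi_curve). Qed.

Lemma costate_neq0 t : t0 <= tbar -> t0 <= t -> grad h (x tbar) != 0 ->
  costate t != 0.
Proof.
move=> tb tt; apply: contraNN => /eqP ct0.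
have unitP s : t0 <= s -> Phi s \in unitmx.
  by move=> ts; exact: (fundamental_matrix_unit A_bounded Phi0 Phi_curve).
rewrite -(costate_terminal tb) trmx_eq0 /costate.
have -> : (Phi tbar)^T *m (grad h (x tbar))^T = (Phi t)^T *m costate t.
  by rewrite /costate [RHS]mulmxA -[(Phi t)^T *m _]trmx_mul mulVmx ?unitP// trmx1 mul1mx.
by rewrite ct0 !mulmx0.
Qed.

(** By normalization the times s close to tbar with d s close to d tbar do not
    form a null set, so the equality that holds almost everywhere holds at one
    of them; it passes to the limit by continuity of the costate, x and f. *)
Lemma costate_terminal_stationary : t0 < tbar -> normalized_at_left d tbar ->
  (grad h (x tbar) *m f (x tbar) (d tbar)) 0 0 = 0.
Proof.
move=> t0b norm; have tb := ltW t0b.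
have dDt : D (d tbar) by exact: dd.1.
apply/eqP; rewrite -normr_le0; apply/ler_addgt0Pr => e e0; rewrite add0r.
set F0 := f (x tbar) (d tbar).
pose c1 := n%:R * `|grad h (x tbar)|.
pose c2 := n%:R * (`|F0| + 1).
have c10 : 0 <= c1 by rewrite mulr_ge0.
have c20 : 0 <= c2 by rewrite mulr_ge0// addr_ge0.
have e10 : 0 < Num.min 1 (e / (2 * (c1 + 1))).
  by rewrite lt_min ltr01 divr_gt0// mulr_gt0// ltr_wpDl.
have e20 : 0 < e / (2 * (c2 + 1)) by rewrite divr_gt0// mulr_gt0// ltr_wpDl.
have [cf _ _ _ _] := C2f.
have /cvgrPdist_lt/(_ _ e10)/nbhs_ballP[r /= r0 Hr] := cf (x tbar) _ (DU dDt).
have [dx dx0 Hdx] := abs_continuous_dist (cx.1 _ tb) r0.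
have [dl dl0 Hdl] := abs_continuous_dist (costate_adjoint.1 _ tb) e20.
pose delta := Num.min (tbar - t0) (Num.min dx dl).
have delta0 : 0 < delta by rewrite !lt_min subr_gt0 t0b dx0.
have [s [[s1 s2 s3] ps]] : exists s, [/\ tbar - delta < s, s < tbar &
    `|d s - d tbar| < r] /\ ((costate s)^T *m f (x s) (d s)) 0 0 = 0.
  apply: contrapT => ns; apply: (norm r delta r0 delta0).
  apply: negligibleS costate_stationary => s /= [s1 s2 s3] H.
  apply: ns; exists s; split => //; apply: H; last exact: ltW.
  have : delta <= tbar - t0 by rewrite ge_min lexx.
  lra.
have [D1 D2 D3] : [/\ delta <= tbar - t0, delta <= dx & delta <= dl].
  by rewrite /delta !ge_min !lexx !orbT.
have ts : t0 <= s by lra.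
have sb := ltW s2.
have sd : `|s - tbar| < delta by rewrite ltr0_norm ?subr_lt0//; lra.
have xs := Hdx s tbar ts sb tb (lexx _) (lt_le_trans sd D2).
have ls := Hdl s tbar ts sb tb (lexx _) (lt_le_trans sd D3).
set F := f (x s) (d s) in ps.
have : `|F0 - F| < Num.min 1 (e / (2 * (c1 + 1))).
  by apply: (Hr (x s, d s)); split => /=; rewrite -ball_normE /ball_/= distrC.
rewrite lt_min => /andP[F1 F2].
have -> : (grad h (x tbar) *m F0) 0 0 =
    (grad h (x tbar) *m (F0 - F)) 0 0 - ((costate s - costate tbar)^T *m F) 0 0.
  have entryB (B C : 'M[R]_1) : (B - C) 0 0 = B 0 0 - C 0 0 by rewrite !mxE.
  rewrite (_ : (costate s - _)^T = (costate s)^T - grad h (x tbar)).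
    by rewrite mulmxBr mulmxBl !entryB ps sub0r opprK subrK.
  by rewrite -costate_terminal// linearB.
have Fn : `|F| <= `|F0| + 1.
  rewrite -(subrK F0 F) addrC; apply: le_trans (ler_normD _ _) _.
  by rewrite lerD2l distrC ltW.
apply: le_trans (ler_normB _ _) _.
have G1 : `|(grad h (x tbar) *m (F0 - F)) 0 0| <= e / 2.
  apply: le_trans (mulmx_entry_norm _ _) _; rewrite -/c1.
  apply: le_trans (ler_wpM2l c10 (ltW F2)) _.
  rewrite mulrA ler_pdivrMr ?mulr_gt0 ?ltr_wpDl//; lra.
have G2 : `|((costate s - costate tbar)^T *m F) 0 0| <= e / 2.
  apply: le_trans (mulmx_entry_norm _ _) _.
  apply: (@le_trans _ _ (n%:R * (e / (2 * (c2 + 1))) * (`|F0| + 1))).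
    rewrite ler_pM ?mulr_ge0// ler_wpM2l// (le_trans (mx_norm_trmx _))// ltW//.
  rewrite mulrAC -/c2 mulrA ler_pdivrMr ?mulr_gt0 ?ltr_wpDl//; lra.
lra.
Qed.

End Pullback.
End Flow.

(** * The maximal invariant set and its barrier *)

Section MaximalInvariantSet.
Context {R : realType} {n m p : nat}.
Variables (t0 : R) (f : 'cV[R]_n -> 'cV[R]_m -> 'cV[R]_n).
Variables (U D : set 'cV[R]_m) (g : 'I_p -> 'cV[R]_n -> R).

Lemma MRPI_RPI : RPI t0 f D (MRPI t0 f D g).
Proof.
move=> x0 d x [A [rpiA AG] Ax0] dd cx t tt.
by exists A => //; exact: (rpiA x0 d).
Qed.

Lemma MRPI_sub : MRPI t0 f D g `<=` Gset g.
Proof. by move=> x [A [_ AG] /AG]. Qed.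

Lemma closure_sub_Gset (M : set 'cV[R]_n) :
  (forall i, continuous (g i)) -> M `<=` Gset g -> closure M `<=` Gset g.
Proof.
move=> cg MG x Mx i; rewrite leNgt; apply/negP => gx.
have /cvgrPdist_lt/(_ _ gx) near_x := cg i x.
have [y [/MG/(_ i) gy /=]] := Mx _ near_x.
by apply/negP; rewrite -leNgt; apply: le_trans (ler_norm _); rewrite lerDl oppr_ge0.
Qed.

Hypotheses (DU : D `<=` U) (cD : compact D) (C2f : C2_in_fst U f).
Hypotheses (wp : well_posed t0 f D) (cg : forall i, continuous (g i)).

(** The closure of M is itself an invariant subset of the closed set of
    constraints, and M is the largest one. *)
Lemma closure_MRPI : closure (MRPI t0 f D g) `<=` MRPI t0 f D g.
Proof.
move=> x Mx; exists (closure (MRPI t0 f D g)) => //; split.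
  by apply: (closure_RPI DU cD C2f wp); exact: MRPI_RPI.
by apply: closure_sub_Gset => //; exact: MRPI_sub.
Qed.

End MaximalInvariantSet.

Theorem theorem1 (R : realType) (n m p : nat) (t0 : R)
  (f : 'cV[R]_n -> 'cV[R]_m -> 'cV[R]_n) (D : set 'cV[R]_m)
  (g : 'I_p -> 'cV[R]_n -> R)
  (A1_compact : compact D) (A1_convex : convex_subset D)
  (A2 : exists U : set 'cV[R]_m,
     [/\ open U, D `<=` U, C2_in_snd U f & C2_in_fst U f])
  (A3 : well_posed t0 f D)
  (A4 : forall x, convex_subset [set f x d | d in D])
  (A5_C2 : forall i, C2 (g i))
  (A5_manifold : forall i, defines_manifold (g i))
  (A6 : exists2 T : R, t0 <= T & MRPI_upto t0 f D g T = MRPI t0 f D g)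
  (xbar : 'cV[R]_n) (dbar : R -> 'cV[R]_m) (tbar : R) (x : R -> 'cV[R]_n)
  (h_xbar : barrier t0 f D g xbar)
  (h_dbar : disturbances t0 D dbar)
  (h_norm : normalized_at_left dbar tbar)
  (h_tbar : t0 <= tbar)
  (h_x : trajectory t0 f dbar xbar x)
  (h_barrier : forall t, t0 <= t -> t < tbar -> barrier t0 f D g (x t))
  (h_z : Gzero g (x tbar)) :
  exists (istar : 'I_p) (lambda : R -> 'cV[R]_n),
    [/\ active g (x tbar) istar /\
        is_max_over (active g (x tbar))
          (fun i => Lie f g i (x tbar) (dbar tbar))
          (Lie f g istar (x tbar) (dbar tbar)),
        [/\ adjoint_curve t0 f dbar x lambda,
            lambda tbar = (grad (g istar) (x tbar))^T &
            forall t, t0 <= t -> lambda t != 0],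
        {ae lebesgue_measure, forall t : R, t0 <= t -> t <= tbar ->
           is_max_over D (fun d => ((lambda t)^T *m f (x t) d) 0 0)
             (((lambda t)^T *m f (x t) (dbar t)) 0 0) /\
           ((lambda t)^T *m f (x t) (dbar t)) 0 0 = 0} &
        [/\ is_max_over D (max_active_Lie f g (x tbar))
              (max_active_Lie f g (x tbar) (dbar tbar)),
            max_active_Lie f g (x tbar) (dbar tbar) =
              Lie f g istar (x tbar) (dbar tbar) &
            Lie f g istar (x tbar) (dbar tbar) = 0]].
Proof.
have [U [_ DU _ C2f]] := A2.
have [cx x0E] := h_x.
have DdT t : t0 <= t -> D (dbar t) := h_dbar.1 t.
set M := MRPI t0 f D g.
have rpiM : RPI t0 f D M by exact: MRPI_RPI.
have Mxbar : M xbar.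
  apply: (closure_MRPI DU A1_compact C2f A3); last by have [[]] := h_xbar.
  by move=> i; case: (A5_C2 i).
have Mx t : t0 <= t -> M (x t) by exact: (rpiM xbar dbar).
have [istar gz] := h_z.
have t0b : t0 < tbar.
  rewrite lt_neqAle h_tbar andbT; apply/eqP => tE.
  have [_ /(_ istar)] := h_xbar.
  by rewrite -x0E tE gz ltxx.
have [Phi Phi0 PhiC] := fundamental_matrix
  (fun v => variational_solution DU A1_compact C2f A3 v h_dbar cx).
have Mg i y : M y -> g i y <= 0 by move/MRPI_sub.
have Lie_le i q : active g (x tbar) i -> D q -> Lie f g i (x tbar) q <= 0.
  move=> ai Dq.
  have := costate_nonpos DU A1_compact C2f A3 h_dbar cx Phi0 PhiC (A5_C2 i) rpiM
    (Mg i) ai Mx h_tbar (lexx _) Dq.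
  by rewrite (costate_terminal DU A1_compact C2f h_dbar cx Phi0 PhiC).
have Lie_eq i : active g (x tbar) i -> Lie f g i (x tbar) (dbar tbar) = 0.
  move=> ai.
  exact: (costate_terminal_stationary DU A1_compact C2f A3 h_dbar cx Phi0 PhiC
    (A5_C2 i) rpiM (Mg i) ai Mx t0b h_norm).
have max0 : max_active_Lie f g (x tbar) (dbar tbar) = 0.
  rewrite /max_active_Lie (_ : [set _ | _ in _] = [set 0]) ?sup1//.
  apply/seteqP; split => [_ [i ai <-]|_ ->]; first exact: Lie_eq.
  by exists istar => //; exact: Lie_eq.
exists istar, (costate x Phi (g istar) tbar); split.
- split=> //; split; first by exists istar.
  by move=> i ai; rewrite !Lie_eq.
- split.
  + exact: (costate_adjoint DU A1_compact C2f h_dbar cx Phi0 PhiC).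
  + by rewrite -(costate_terminal DU A1_compact C2f h_dbar cx Phi0 PhiC) ?trmxK.
  + move=> t tt; apply: (costate_neq0 DU A1_compact C2f h_dbar cx Phi0 PhiC) => //.
    exact: A5_manifold.
- have := costate_stationary DU A1_compact C2f A3 h_dbar cx Phi0 PhiC
    (A5_C2 istar) rpiM (Mg istar) gz Mx.
  apply: filterS => t st tt tb; rewrite st//; split=> //; split.
    by exists (dbar t); [exact: DdT|exact: st].
  move=> q Dq.
  exact: (costate_nonpos DU A1_compact C2f A3 h_dbar cx Phi0 PhiC (A5_C2 istar)
    rpiM (Mg istar) gz Mx).
- rewrite max0 Lie_eq//; split=> //; split.
    by exists (dbar tbar) => //; exact: DdT.
  move=> q Dq; apply: ge_sup; first by exists (Lie f g istar (x tbar) q), istar.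
  by move=> _ [i ai <-]; exact: Lie_le.
Qed.
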